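(* There exist absolute constants $0<c<C$ such that the following holds. Let $p$ be an odd prime. For $\epsilon>0$ let $n_p(\epsilon)$ be the least positive integer such that, for each $n\ge n_p(\epsilon)$ and every subset $A\subseteq \mathbb{F}_p^n$ of density $\alpha=|A|/p^n$, there is a nonzero $d\in\mathbb{F}_p^n$ such that the density of three-term arithmetic progressions with common difference $d$ in $A$ is at least $\alpha^3-\epsilon$. Then for every $0<\epsilon\le 2^{-161}p^{-8}$, $n_p(\epsilon)$ is bounded from below and above by exponential towers of $p$'s of height $\Theta(\log(1/\epsilon))$, i.e. $$T_p\big(\lfloor c\log(1/\epsilon)\rfloor\big)\le n_p(\epsilon)\le T_p\big(\lceil C\log(1/\epsilon)\rceil\big).$$
   Context: The density of three-term arithmetic progressions with common difference $d$ in a set $A\subseteq\mathbb{F}_p^n$ is $|\{x\in\mathbb{F}_p^n : x,\ x+d,\ x+2d\in A\}|/p^n$. $T_p(h)$ denotes the exponential tower of $p$'s of height $h$: $T_p(0)=1$ and $T_p(h+1)=p^{T_p(h)}$ for integers $h\ge 0$. $\log$ is the logarithm to base $2$. *)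

(* Defs.v *)
From HB Require Import structures.
From mathcomp Require Import all_boot all_order all_algebra.
From mathcomp Require Import reals exp.

Set Implicit Arguments.
Unset Strict Implicit.
Unset Printing Implicit Defensive.

Import Order.TTheory GRing.Theory Num.Theory.

Local Open Scope ring_scope.

(* For prime [p], the space F_p^n is ['rV['F_p]_n]; for non-prime [p] the field
   ['F_p] does not have [p] elements and the densities below are not meant to
   be used. *)

Definition density (R : realType) (p n : nat) (A : {set 'rV['F_p]_n}) : R :=
  #|A|%:R / (p ^ n)%:R.

Definition ap3_density (R : realType) (p n : nat) (A : {set 'rV['F_p]_n})
    (d : 'rV['F_p]_n) : R :=
  #|[set x | [&& x \in A, x + d \in A & x + d *+ 2 \in A]]|%:R / (p ^ n)%:R.

Definition has_popular_difference (R : realType) (p : nat) (eps : R) (n : nat) :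
    Prop :=
  forall A : {set 'rV['F_p]_n},
    exists2 d : 'rV['F_p]_n, d != 0 &
      density R A ^+ 3 - eps <= ap3_density R A d.

Definition popular_from (R : realType) (p : nat) (eps : R) (N : nat) : Prop :=
  forall n : nat, (N <= n)%N -> has_popular_difference p eps n.

(* [N] is n_p(eps), the least positive integer satisfying [popular_from]. *)
Definition is_popular_threshold (R : realType) (p : nat) (eps : R) (N : nat) :
    Prop :=
  [/\ (0 < N)%N, popular_from p eps N &
      forall M : nat, (0 < M)%N -> popular_from p eps M -> (N <= M)%N].

Definition tower (p h : nat) : nat := iter h (expn p) 1%N.

Definition log2 (R : realType) (x : R) : R := ln x / ln 2.

(* Main.v *)
Require Import Defs.
From HB Require Import structures.
From mathcomp Require Import all_boot all_order all_algebra.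
From mathcomp Require Import reals exp.
From mathcomp Require Import all_field boolp sequences.
From mathcomp Require Import zify ring lra.

Set Implicit Arguments.
Unset Strict Implicit.
Unset Printing Implicit Defensive.

Import Order.TTheory GRing.Theory Num.Theory.

Local Open Scope ring_scope.

(**
Both bounds are elementary.  Write V for the space.

Upper bound.  Let f be the indicator function of A and alpha its mean.  For a
subspace H let f_H be the average of f over the cosets of H and let b(H) be the
mean of f_H ^ 3, the mean cube density; it is alpha ^ 3 for H = V and never
exceeds 1.  If no nonzero difference is popular, then the
density of progressions x, x + d, x + 2d in A with x in V and d in H is below
alpha ^ 3 - eps, up to the contribution 1 / #|H| of d = 0.  Fourier analysis
on the cosets of H (regularity) gives a subspace H' of H, whose codimension is
a single exponential in that of H, such that replacing f by f_H' hardly alters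
this density.  The decisive point is a convexity inequality (ap_sum_convex):
the density of progressions with difference in H, weighted by f_H', is at
least 2 b(H) - b(H').  Therefore
  b(H') - alpha ^ 3 >= 2 (b(H) - alpha ^ 3) + eps / 2,
the excess of the mean cube doubles (mean_cube_increment), and this can happen
only log (1 / eps) + O(1) times.  Each time costs one exponential.

Lower bound.  A set without popular differences is built in stages on spaces
of tower-like growing dimension.  At each stage there is a function on V whose
values are 0, 1 and a fixed number alpha in [2/3, 4/5] (not the mean of A), such that every nonzero
d already has progression density below beta ^ 3 - eps, where beta is the mean.
The first stage is alpha times the indicator of the nonzero vectors
(stage_init).  To pass from V to V * W, a small set Y of points where the value
is alpha is chosen, and for x in Y the constant alpha on the fibre above x is
replaced by the indicator of { y : y . v(x) lies outside an interval of F_p },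
a set of density alpha in the fibre, for a suitable map v : V -> W.
- If d moves the V-coordinate, then v(x), v(x+d), v(x+2d) are linearly
  independent, the three factors decouple in the fibre, and the progression
  density is what it was before (ap_refine_old).
- If d fixes the V-coordinate, the fibres above Y contribute less than they
  would for independent values, because the complement of an interval has
  fewer progressions than a random set of its density (sum_outside_gap_ap);
  this deficit outweighs the excess of the mean of the cube of the function
  over beta ^ 3 as soon as Y is a large constant times larger than the set of
  points that were fixed before (stage_step).
A random v works, by a Chernoff bound, even if dim W is proportional to
#|Y| / p, hence exponential in dim V (directions_exist).  So the density of the
points with value 0 or 1 grows by a constant factor per stage while the
dimension grows exponentially, and the number of stages available is of order
log (1 / eps).
At the last stage Y consists of all remaining points, and the function becomes
the indicator of a set.
*)

(** * The Fourier transform and three-term progressions *)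

Section Dot.
Variables (F : fieldType) (n : nat).
Implicit Types x y : 'rV[F]_n.

Definition dot x y : F := (x *m y^T) 0 0.

Lemma dotDl x y w : dot (x + y) w = dot x w + dot y w.
Proof. by rewrite /dot mulmxDl mxE. Qed.

Lemma dotZl a x w : dot (a *: x) w = a * dot x w.
Proof. by rewrite /dot -scalemxAl mxE. Qed.

Lemma dotC x y : dot x y = dot y x.
Proof. by rewrite /dot -{1}[x]trmxK -trmx_mul mxE. Qed.

Lemma dotDr w x y : dot w (x + y) = dot w x + dot w y.
Proof. by rewrite dotC dotDl !(dotC w). Qed.

Lemma dotZr a w x : dot w (a *: x) = a * dot w x.
Proof. by rewrite dotC dotZl (dotC w). Qed.

Lemma dotBl x y w : dot (x - y) w = dot x w - dot y w.
Proof. by rewrite -scaleN1r dotDl dotZl mulN1r. Qed.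

Lemma dot0l w : dot 0 w = 0.
Proof. by rewrite -(scale0r 0) dotZl mul0r. Qed.

Lemma dot_nondegenerate x : x != 0 -> exists y, dot x y = 1.
Proof.
case/rV0Pn => i xi_neq0; exists ((x 0 i)^-1 *: delta_mx 0 i).
by rewrite dotZr /dot trmx_delta -colE mxE mulVf.
Qed.
End Dot.

Section Means.
Variables (V : finZmodType) (K : fieldType).
Implicit Types (g : V -> K) (H : {set V}).

Definition ap_sum H g : K :=
  \sum_x \sum_(d in H) g x * g (x + d) * g (x + d *+ 2).

Definition coset_mean H g (x : V) : K := (\sum_(h in H) g (x + h)) / #|H|%:R.
End Means.

Lemma half_double (K : numFieldType) (x : K) : x = (x + x) / 2.
Proof. by field. Qed.

Section Fourier.
Variables (p : nat) (p_pr : prime p) (p_odd : odd p) (n : nat).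
Variables (C : numClosedFieldType) (zeta : C).
Hypothesis zetaP : p.-primitive_root zeta.
Local Notation V := 'rV['F_p]_n.
Implicit Types (g : V -> C) (x d xi : V) (H : {set V}).

Definition addchar (a : 'F_p) : C := zeta ^+ a.

Lemma addcharD a b : addchar (a + b) = addchar a * addchar b.
Proof.
rewrite /addchar -exprD -(prim_expr_mod zetaP (a + b)%N) /=.
by congr (_ ^+ (_ %% _)); rewrite Fp_cast.
Qed.

Lemma addchar0 : addchar 0 = 1.
Proof. by rewrite /addchar expr0. Qed.

Lemma norm_addchar a : `|addchar a| = 1.
Proof.
suff z1 : `|zeta| = 1 by rewrite /addchar normrX z1 expr1n.
have := pexpr_eq1 (prime_gt0 p_pr) (normr_ge0 zeta).
by rewrite -normrX (prim_expr_order zetaP) normr1 eqxx => /esym/eqP.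
Qed.

Lemma conj_addchar a : (addchar a)^* = addchar (- a).
Proof.
have n0 : addchar a != 0 by rewrite -normr_eq0 norm_addchar oner_eq0.
by apply: (mulfI n0); rewrite -normCK norm_addchar expr1n -addcharD subrr addchar0.
Qed.

Lemma addchar1_neq1 : addchar 1 != 1.
Proof.
rewrite /addchar /= modn_small; last by rewrite Fp_cast // prime_gt1.
have := prim_order_dvd zetaP 1; rewrite expr1 => <-.
by rewrite dvdn1 neq_ltn prime_gt1 ?orbT.
Qed.

(** A translation in direction y with x . y = 1 multiplies the sum by a nontrivial
    root of unity. *)
Lemma sum_addchar x : \sum_xi addchar (dot x xi) = (x == 0)%:R * #|{: V}|%:R.
Proof.
have [->|x0] := eqVneq x 0.
  by under eq_bigr do rewrite dot0l addchar0; rewrite sumr_const mul1r.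
have [y xy] := dot_nondegenerate x0; rewrite mul0r.
set S := LHS; have : S = S * addchar 1.
  rewrite {1}/S (reindex_inj (addIr y)) /= mulr_suml.
  by apply: eq_bigr => xi _; rewrite dotDr xy addcharD.
move/eqP; rewrite eq_sym -subr_eq0 -{2}[S]mulr1 -mulrBr mulf_eq0 subr_eq0.
by rewrite (negPf addchar1_neq1) orbF => /eqP.
Qed.

Definition fourier g xi : C := \sum_x g x * addchar (dot x xi).

(** Only real functions occur, so the square stands for the square modulus. *)
Lemma parseval g : (forall x, g x \is Num.real) ->
  \sum_xi `|fourier g xi| ^+ 2 = #|{: V}|%:R * \sum_x g x ^+ 2.
Proof.
move=> g_real.
transitivity (\sum_xi \sum_x \sum_y g x * g y * addchar (dot (x - y) xi)).
  apply: eq_bigr => xi _; rewrite normCK rmorph_sum /= big_distrlr /=.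
  apply: eq_bigr => x _; apply: eq_bigr => y _.
  rewrite rmorphM /= conj_addchar (conj_Creal (g_real y)) dotBl addcharD; ring.
rewrite exchange_big mulr_sumr; apply: eq_bigr => x _ /=.
rewrite exchange_big (bigD1 x) //= -mulr_sumr subrr sum_addchar eqxx.
rewrite mul1r big1 ?addr0; first by ring.
move=> y yx; rewrite -mulr_sumr sum_addchar subr_eq0 eq_sym (negPf yx).
by rewrite mul0r mulr0.
Qed.

Lemma two_neq0 : 2 != 0 :> 'F_p.
Proof.
rewrite -(dvdn_pcharf (pchar_Fp p_pr)) dvdn_prime2 //.
by apply: contraTneq p_odd => ->.
Qed.

(** The points x and y = x + 2d determine a progression with middle point z = x + d
    by x + y - 2z = 0, and this equation is detected by summing over all characters. *)
Lemma ap_sum_fourier g :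
  #|{: V}|%:R * ap_sum setT g
  = \sum_xi fourier g xi ^+ 2 * fourier g (- 2%:R *: xi).
Proof.
transitivity (\sum_xi \sum_x \sum_z \sum_y
   g x * g z * g y * addchar (dot (x + y - z *+ 2) xi)); last first.
  apply: eq_bigr => xi _.
  rewrite expr2 -mulrA [X in _ * X]mulrC /fourier mulr_suml.
  apply: eq_bigr => x _; rewrite big_distrlr mulr_sumr /=.
  apply: eq_bigr => z _; rewrite mulr_sumr; apply: eq_bigr => y _.
  rewrite dotZr dotBl dotDl -scaler_nat dotZl mulNr !addcharD.
  ring.
rewrite exchange_big mulr_sumr; apply: eq_bigr => x _ /=.
rewrite exchange_big [RHS](reindex_inj (addrI x)) mulr_sumr /=.
apply: eq_big => [d|d _]; first by rewrite inE.
rewrite exchange_big /= (bigD1 (x + d *+ 2)) //=.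
have -> : x + (x + d *+ 2) - (x + d) *+ 2 = 0.
  by rewrite mulrnDl addrA addrAC subrr.
rewrite -mulr_sumr sum_addchar eqxx mul1r big1 ?addr0; first by ring.
move=> y yx; rewrite -mulr_sumr sum_addchar.
case: eqP => [/eqP|_]; last by rewrite mul0r mulr0.
rewrite mulrnDl subr_eq add0r mulr2n -addrA => /eqP/addrI e.
by case/eqP: yx.
Qed.

(** Averaging over H is a convolution, so it multiplies each frequency by a number. *)
Lemma fourier_coset_mean H g xi :
  fourier (coset_mean H g) xi
  = fourier g xi * ((\sum_(h in H) addchar (dot (- h) xi)) / #|H|%:R).
Proof.
rewrite /fourier mulrA; under eq_bigr do rewrite /coset_mean mulrAC mulr_suml.
rewrite -mulr_suml exchange_big /= mulr_sumr; congr (_ / _).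
apply: eq_bigr => h _; rewrite mulr_suml (reindex_inj (addIr (- h))) /=.
by apply: eq_bigr => x _; rewrite subrK dotDl addcharD mulrA.
Qed.

(** Frequencies that vanish on H are unaffected by averaging over H.  At every other
    frequency one of the three Fourier coefficients is at most theta, and the
    other two are summed by Cauchy-Schwarz and Parseval. *)
Lemma ap_sum_coset_mean (theta : C) H g :
    (forall x, g x \is Num.real) -> 0 \in H -> 0 <= theta ->
    (forall xi, {in H, forall h, dot h xi = 0} \/ `|fourier g xi| <= theta) ->
  `|ap_sum setT g - ap_sum setT (coset_mean H g)|
  <= theta *+ 2 * \sum_x g x ^+ 2.
Proof.
move=> g_real H0 theta_ge0 small.
pose w xi := (\sum_(h in H) addchar (dot (- h) xi)) / #|H|%:R.
have H_gt0 : 0 < #|H|%:R :> C by rewrite ltr0n; apply/card_gt0P; exists 0.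
have w_le1 xi : `|w xi| <= 1.
  rewrite normrM normfV normr_nat ler_pdivrMr // mul1r.
  apply: le_trans (ler_norm_sum _ _ _) _.
  by under eq_bigr do rewrite norm_addchar; rewrite sumr_const.
have w1 xi : {in H, forall h, dot h xi = 0} -> w xi = 1.
  move=> Hxi; rewrite /w (eq_bigr (fun=> 1)) ?sumr_const ?divff ?gt_eqF //.
  by move=> h /Hxi e; rewrite -scaleN1r dotZl e mulr0 addchar0.
have V_gt0 : 0 < #|{: V}|%:R :> C by rewrite ltr0n; apply/card_gt0P; exists 0.
rewrite -(ler_pM2l V_gt0) -[X in X * `|_|](gtr0_norm V_gt0) -normrM mulrBr.
rewrite !ap_sum_fourier -sumrB mulrCA -(parseval g_real).
clear V_gt0.
have -> : \sum_xi `|fourier g xi| ^+ 2 = (\sum_xi `|fourier g xi| ^+ 2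
     + \sum_xi `|fourier g (- 2%:R *: xi)| ^+ 2) / 2.
  rewrite [X in _ = (_ + X) / _](_ : _ = \sum_xi `|fourier g xi| ^+ 2).
    exact: half_double.
  have bij2 : injective (fun xi : V => - 2%:R *: xi).
    by apply: scalerI; rewrite oppr_eq0 two_neq0.
  by rewrite [RHS](reindex_inj bij2).
rewrite -big_split mulr_suml mulr_sumr /=.
apply: le_trans (ler_norm_sum _ _ _) (ler_sum _ _) => xi _.
rewrite !fourier_coset_mean -!/(w _).
case: (small xi) => [Hxi|le_theta].
  rewrite !w1 // => [|h /Hxi]; last by rewrite dotZr => ->; rewrite mulr0.
  rewrite !mulr1 subrr normr0 mulr_ge0 //.
    by rewrite mulrn_wge0.
  by rewrite mulr_ge0 ?invr_ge0 ?ler0n // addr_ge0 ?exprn_ge0.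
move: le_theta (w_le1 xi) (w_le1 (- 2%:R *: xi)).
move: (fourier g xi) (fourier g (- 2%:R *: xi)) (w xi) (w (- 2%:R *: xi))
  => a b u1 w2 le_theta w1_le w2_le.
rewrite (_ : _ - _ = a * (a * b) * (1 - u1 ^+ 2 * w2)); last ring.
rewrite !normrM -mulrA mulrnAl -mulrnAr ler_pM ?mulr_ge0 // -[leRHS]mulr_natr.
apply: ler_pM; rewrite ?mulr_ge0 //.
  rewrite ler_pdivlMr // mulr_natr -subr_ge0.
  rewrite (_ : _ - _ = (`|a| - `|b|) ^+ 2); last by ring.
  by rewrite real_exprn_even_ge0 // rpredB ?normr_real.
rewrite (le_trans (ler_normB _ _)) // normr1 -[leRHS]natr1 mulr1n lerD2l normrM normrX.
by rewrite mulr_ile1 ?exprn_ge0 // exprn_ile1.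
Qed.
End Fourier.

(** * Annihilators, and functions localised to cosets *)

Section Subgroup.
Variables (V : finZmodType) (H : {set V}) (H_zmod : zmod_closed H).

Lemma subgroup0 : 0 \in H. Proof. by case: H_zmod. Qed.

Lemma subgroupN x : x \in H -> - x \in H.
Proof. by case: H_zmod => H0 HB Hx; rewrite -sub0r HB. Qed.

Lemma subgroupDr x h : h \in H -> (x + h \in H) = (x \in H).
Proof.
case: H_zmod => _ HB Hh; apply/idP/idP => Hx.
  by rewrite -(addrK h x) HB.
by rewrite -[h]opprK HB // subgroupN.
Qed.

Lemma card_coset a : #|[set x | x - a \in H]| = #|H|.
Proof.
rewrite -(card_imset H (addIr a)); apply: eq_card => x; rewrite inE.
apply/idP/imsetP => [Hx|[y Hy ->]]; last by rewrite addrK.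
by exists (x - a); rewrite ?subrK.
Qed.

Lemma card_subgroup_gt0 : (0 < #|H|)%N.
Proof. by apply/card_gt0P; exists 0; exact: subgroup0. Qed.

End Subgroup.

Section Perp.
Variables (p : nat) (p_pr : prime p) (n : nat).
Local Notation V := 'rV['F_p]_n.
Implicit Types (Xi : {set V}).

(** A subspace is given by a finite set of linear equations, so that its codimension is
    controlled by the number of equations. *)
Definition perp Xi : {set V} := [set x | [forall xi in Xi, dot x xi == 0]].

Lemma perpP Xi x : reflect {in Xi, forall xi, dot x xi = 0} (x \in perp Xi).
Proof. by rewrite inE; apply: (iffP forall_inP) => H xi /H /eqP. Qed.

Lemma perp_zmod Xi : zmod_closed (perp Xi).
Proof.
split=> [|x y /perpP Hx /perpP Hy]; apply/perpP => xi Xi_xi.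
  by rewrite dot0l.
by rewrite dotBl Hx ?Hy // subrr.
Qed.

Lemma perpS Xi Xi' : Xi \subset Xi' -> perp Xi' \subset perp Xi.
Proof. by move/subsetP=> s; apply/subsetP=> x /perpP Hx; apply/perpP=> xi /s/Hx. Qed.

Lemma perp_set0 : perp set0 = setT.
Proof. by apply/setP=> x; rewrite !inE; apply/forall_inP => xi; rewrite inE. Qed.

(** The values of the equations on x determine the coset of x. *)
Lemma card_perp Xi : (p ^ n <= p ^ #|Xi| * #|perp Xi|)%N.
Proof.
pose val_on x : {ffun V -> 'F_p} := [ffun xi => if xi \in Xi then dot x xi else 0].
have <- : #|{: V}| = (p ^ n)%N by rewrite card_mx card_Fp // mul1n.
rewrite -[leqLHS]sum1_card (partition_big val_on (mem (pffun_on 0 (mem Xi) predT))) /=.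
  have <- : #|pffun_on (0 : 'F_p) (mem Xi) predT| = (p ^ #|Xi|)%N.
    by rewrite card_pffun_on; congr (_ ^ _)%N; apply: etrans (card_Fp p_pr).
  rewrite -sum_nat_const; apply: leq_sum => v _.
  have [x /eqP <-|no] := pickP (fun x => val_on x == v); last first.
    by rewrite big_pred0.
  rewrite -(card_coset (perp Xi) x) sum1_card subset_leq_card //.
  apply/subsetP => y; move=> yx; have /eqP/ffunP eyx : val_on y == val_on x := yx; rewrite inE.
  apply/perpP => xi Xi_xi; have := eyx xi.
  by rewrite !ffunE Xi_xi dotBl => ->; rewrite subrr.
move=> x _; apply/pffun_onP; split=> //.
by apply/subsetP => xi; rewrite inE ffunE; case: ifP => //; rewrite eqxx.
Qed.
End Perp.

Section Localise.
Variables (V : finZmodType) (C : numFieldType).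
Variables (H : {set V}) (H_zmod : zmod_closed H).
Implicit Types (g : V -> C) (a x : V).

(** Working with functions on the whole space that are cut off to a coset a + H avoids
    choosing coordinates on H and using the dual group of H. *)
Definition localise g a x : C := (x - a \in H)%:R * g x.

Lemma localiseDr g a h : h \in H -> localise g (a + h) =1 localise g a.
Proof.
by move=> Hh x; rewrite /localise opprD addrA (subgroupDr H_zmod _ (subgroupN H_zmod Hh)).
Qed.

Lemma sum_coset_indicator x : \sum_a (x - a \in H)%:R = #|H|%:R :> C.
Proof.
rewrite -(card_coset H x) -sum1_card natr_sum [RHS]big_mkcond /=.
apply: eq_bigr => a _; rewrite inE -(opprB a) -mulrb.
by congr ((nat_of_bool _)%:R); apply/idP/idP => /(subgroupN H_zmod); rewrite ?opprK.
Qed.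

(** A progression with all its points in one coset of H has its difference in H; each
    coset is counted once for each of its #|H| base points. *)
Lemma ap_sum_localise g :
  \sum_a ap_sum setT (localise g a) = #|H|%:R * ap_sum H g.
Proof.
rewrite exchange_big mulr_sumr; apply: eq_bigr => x _ /=.
rewrite exchange_big mulr_sumr [RHS]big_mkcond /=.
apply: eq_big => [d|d _]; first by rewrite inE.
rewrite /localise; case: ifP => Hd.
  rewrite -(sum_coset_indicator x) mulr_suml; apply: eq_bigr => a _.
  have Hd2 : d *+ 2 \in H by rewrite mulr2n subgroupDr.
  rewrite [x + d - a]addrAC [x + d *+ 2 - a]addrAC.
  rewrite (subgroupDr H_zmod _ Hd) (subgroupDr H_zmod _ Hd2); case: (_ \in H) => /=; ring.
rewrite big1 // => a _.
have [Hx|] := boolP (x - a \in H); last by rewrite !mul0r.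
by rewrite [x + d]addrC -addrA (subgroupDr H_zmod _ Hx) Hd mul0r mulr0 mul0r.
Qed.

Lemma coset_mean_localise (H' : {set V}) g a :
    H' \subset H ->
  coset_mean H' (localise g a) =1 localise (coset_mean H' g) a.
Proof.
move/subsetP => sub x; rewrite /coset_mean /localise mulrA; congr (_ / _).
rewrite mulr_sumr; apply: eq_bigr => h /sub Hh.
by rewrite addrAC (subgroupDr H_zmod _ Hh).
Qed.
End Localise.

(** * A regularity lemma *)

Section Regularity.
Variables (p : nat) (p_pr : prime p) (p_odd : odd p) (n : nat).
Local Notation V := 'rV['F_p]_n.
Implicit Types (f : V -> rat) (Xi : {set V}).

Lemma card_rV : #|{: V}| = (p ^ n)%N.
Proof. by rewrite card_mx card_Fp // mul1n. Qed.

Section Fixed.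
Variables (C : numClosedFieldType) (zeta : C).
Hypothesis zetaP : p.-primitive_root zeta.
Variables (F : V -> C) (F01 : forall x, 0 <= F x <= 1).
Variables (H : {set V}) (H_zmod : zmod_closed H).

Let F_real x : F x \is Num.real.
Proof. by case/andP: (F01 x) => /ger0_real. Qed.

Let loc_real a x : localise H F a x \is Num.real.
Proof. by rewrite rpredM // realn. Qed.

(** Every point lies in the coset a + H for exactly #|H| values of a. *)
Lemma sum_localise_sqr :
  \sum_a \sum_x localise H F a x ^+ 2 <= (p ^ n)%:R * #|H|%:R.
Proof.
rewrite exchange_big -card_rV mulr_natl -sumr_const /=.
apply: ler_sum => x _; rewrite -(sum_coset_indicator C H_zmod x).
apply: ler_sum => a _; rewrite /localise exprMn.
case: (_ \in H); rewrite ?expr0n ?mul0r // expr1n mul1r.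
by case/andP: (F01 x) => F0 F1; rewrite exprn_ile1.
Qed.

Definition large_spectrum (theta : C) : {set V} :=
  [set xi | [exists a, theta < `|fourier zeta (localise H F a) xi|]].

(** A frequency that is large for a is large for all #|H| base points of the coset
    a + H, which compensates for counting each coset #|H| times. *)
Lemma card_large_spectrum theta : 0 <= theta ->
  #|large_spectrum theta|%:R * theta ^+ 2 <= (p ^ n)%:R ^+ 2.
Proof.
move=> theta0.
have H_gt0 : 0 < #|H|%:R :> C by rewrite ltr0n (card_subgroup_gt0 H_zmod).
rewrite -(ler_pM2l H_gt0).
apply: (@le_trans _ _ (\sum_xi \sum_a
   `|fourier zeta (localise H F a) xi| ^+ 2)); last first.
  rewrite exchange_big; under eq_bigr do rewrite (parseval p_pr) //.
  rewrite -mulr_sumr card_rV expr2 mulrCA ler_wpM2l ?ler0n // mulrC.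
  exact: sum_localise_sqr.
rewrite mulrCA mulr_natl -sumr_const big_mkcond ler_sum // => xi _.
case: ifP => [|_]; last by apply: sumr_ge0 => a _; rewrite exprn_ge0.
rewrite inE => /existsP[a lt_theta].
rewrite mulr_natl -sumr_const -[X in _ <= X](subrK 0) subr0 addr0.
apply: (@le_trans _ _ (\sum_(h in H)
   `|fourier zeta (localise H F (a + h)) xi| ^+ 2)).
  apply: ler_sum => h Hh; rewrite lerXn2r ?nnegrE //.
  rewrite (_ : fourier _ _ _ = fourier zeta (localise H F a) xi) ?ltW //.
  by apply: eq_bigr => x _; rewrite localiseDr.
rewrite [leRHS](reindex_inj (addrI a)) [leLHS]big_mkcond ler_sum // => h _.
by case: ifP => // _; rewrite exprn_ge0.
Qed.

(** The coset-wise errors of ap_sum_coset_mean, added up. *)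
Lemma ap_sum_large_spectrum theta (H' : {set V}) :
    0 <= theta -> zmod_closed H' -> H' \subset H ->
    {in large_spectrum theta, forall xi, {in H', forall h, dot h xi = 0}} ->
  #|H|%:R * `|ap_sum H F - ap_sum H (coset_mean H' F)|
  <= theta *+ 2 * ((p ^ n)%:R * #|H|%:R).
Proof.
move=> theta0 H'_zmod H'H H'P.
rewrite -[X in X * `|_|]normr_nat -normrM mulrBr -!ap_sum_localise // -sumrB.
apply: le_trans (ler_norm_sum _ _ _) _.
apply: le_trans (_ : \sum_a theta *+ 2 * \sum_x localise H F a x ^+ 2 <= _).
  apply: ler_sum => a _.
  rewrite (_ : ap_sum setT (localise H (coset_mean H' F) a)
     = ap_sum setT (coset_mean H' (localise H F a))); last first.
    by apply: eq_bigr => x _; apply: eq_bigr => d _; rewrite !coset_mean_localise.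
  apply: (ap_sum_coset_mean p_pr p_odd zetaP) => //; first by case: H'_zmod.
  move=> xi; case: (boolP (xi \in large_spectrum theta)) => [|xi_small].
    by move/H'P; left.
  right; move: xi_small; rewrite inE => /existsPn/(_ a).
  by rewrite real_ltNge ?normr_real ?ger0_real // negbK.
by rewrite -mulr_sumr ler_wpM2l ?mulrn_wge0 // sum_localise_sqr.
Qed.
End Fixed.

(** Imposing all frequencies that are large on some coset of H = perp Xi as new equations
    gives a subspace on whose cosets f can be averaged with little effect on the
    progressions with difference in H.  That the number of new equations is a
    single exponential in #|Xi| is what makes each step of the iteration cost
    only one level of the tower.  The function is rational-valued because the
    proof passes through the field of algebraic complex numbers. *)
Lemma regularity f Xi (K : nat) :
    (forall x, 0 <= f x <= 1) -> (0 < K)%N ->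
  exists Xi' : {set V}, [/\ Xi \subset Xi',
    (#|Xi'| <= #|Xi| + 4 * K ^ 2 * p ^ (2 * #|Xi|))%N &
    `|ap_sum (perp Xi) f - ap_sum (perp Xi) (coset_mean (perp Xi') f)|
      <= (p ^ n)%:R * #|perp Xi|%:R / K%:R].
Proof.
move=> f01 K_gt0; set H := perp Xi.
have H_zmod : zmod_closed H := perp_zmod _.
have [zeta zetaP] := C_prim_root_exists (prime_gt0 p_pr).
pose F x : algC := ratr (f x).
have F01 x : 0 <= F x <= 1 by rewrite /F ler0q -(rmorph1 ratr) ler_rat.
pose theta : algC := #|H|%:R / (2 * K)%:R.
have H_gt0 : (0 < #|H|)%N := card_subgroup_gt0 H_zmod.
have theta0 : 0 <= theta by rewrite divr_ge0 ?ler0n.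
have cardS := card_large_spectrum zetaP F01 H_zmod theta0.
set S := large_spectrum _ _ _ _ in cardS.
exists (Xi :|: S); split; first exact: subsetUl.
  apply: leq_trans (leq_card_setU _ _) _; rewrite leq_add2l.
  have leS : (#|S| * #|H| ^ 2 <= (p ^ n) ^ 2 * (2 * K) ^ 2)%N.
    have K2_gt0 : 0 < (2 * K)%:R ^+ 2 :> algC.
      by rewrite exprn_gt0 ?ltr0n ?muln_gt0 ?K_gt0.
    move: cardS; rewrite /theta expr_div_n mulrA ler_pdivrMr //.
    by rewrite -!natrX -!natrM ler_nat.
  rewrite -(@leq_pmul2r (#|H| ^ 2)) ?expn_gt0 ?H_gt0 //.
  apply: leq_trans leS _.
  have := card_perp p_pr Xi; rewrite -/H -leq_sqr => /(leq_mul (leqnn ((2 * K) ^ 2))).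
  by rewrite mulnC => /leq_trans-> //; rewrite !expnMn mulnA -expnM (mulnC 2 #|Xi|).
have H'H : perp (Xi :|: S) \subset H by rewrite perpS ?subsetUl.
have := ap_sum_large_spectrum zetaP F01 H_zmod theta0
  (perp_zmod (Xi :|: S)) H'H _.
move=> /(_ (fun xi Sxi h Hh => perpP _ _ Hh xi (subsetP (subsetUr Xi S) xi Sxi))).
rewrite (mulrC (p ^ n)%:R) mulrCA ler_pM2l ?ltr0n // => le_theta.
rewrite -(ler_rat algC) ratr_norm rmorphB !rmorphM fmorphV !rmorph_nat.
have ratr_ap G : ratr (ap_sum H G) = ap_sum H (fun x => ratr (G x)) :> algC.
  rewrite rmorph_sum; apply: eq_bigr => x _; rewrite rmorph_sum.
  by apply: eq_bigr => d _; rewrite !rmorphM.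
rewrite /= !ratr_ap -/F.
have eqm : (fun x => ratr (coset_mean (perp (Xi :|: S)) f x)) =1
    coset_mean (perp (Xi :|: S)) F.
  by move=> x; rewrite /coset_mean rmorphM fmorphV rmorph_nat rmorph_sum.
rewrite (_ : ap_sum H (fun x => ratr _) = ap_sum H (coset_mean (perp (Xi :|: S)) F)).
  apply: le_trans le_theta _; rewrite le_eqVlt; apply/orP; left; apply/eqP.
  rewrite /theta natrM; field.
  by rewrite pnatr_eq0 -lt0n.
by apply: eq_bigr => x _; apply: eq_bigr => d _; rewrite !eqm.
Qed.
End Regularity.

(** * Convexity of the mean cube *)

Section Convexity.
Variables (K : realFieldType) (V : finZmodType).
Variables (H : {set V}) (H_zmod : zmod_closed H).
Hypothesis double_inj : injective (fun d : V => d *+ 2).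
Hypothesis double_mem : forall d : V, (d *+ 2 \in H) = (d \in H).
Implicit Types (g : V -> K).

Lemma coset_mean_invariant g x d :
  d \in H -> coset_mean H g (x + d) = coset_mean H g x.
Proof.
move=> Hd; congr (_ / _); rewrite [RHS](reindex_inj (addrI d)) /=.
by apply: eq_big => [h|h _]; rewrite ?addrA // addrC (subgroupDr H_zmod _ Hd).
Qed.

Lemma amgm3_norm (a b c : K) :
  - (a * b * c) <= (`|a| ^+ 3 + `|b| ^+ 3 + `|c| ^+ 3) / 3.
Proof.
apply: le_trans (ler_norm _) _; rewrite normrN !normrM.
move: (normr_ge0 a) (normr_ge0 b) (normr_ge0 c).
move: `|a| `|b| `|c| => x y z x0 y0 z0; rewrite ler_pdivlMr // -subr_ge0.
have -> : x ^+ 3 + y ^+ 3 + z ^+ 3 - x * y * z * 3 =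
    (x + y + z) * ((x - y) ^+ 2 + (y - z) ^+ 2 + (z - x) ^+ 2) / 2 by field.
by rewrite divr_ge0 // mulr_ge0 ?addr_ge0 // sqr_ge0.
Qed.

(** Expanding (m + h) ^ 3, this is the excess of the cube of m + h over its linear
    approximation; nonnegativity of m + h keeps the negative part of h in check. *)
Lemma cube_norm_le (m h : K) :
  0 <= m -> 0 <= m + h -> `|h| ^+ 3 <= 3 * m * h ^+ 2 + h ^+ 3.
Proof.
move=> m0 mh0; have [h0|h0] := ger0P h.
  by rewrite ler_wpDl // !mulr_ge0 // sqr_ge0.
rewrite -subr_ge0 (_ : _ - _ = h ^+ 2 * (3 * m + 2 * h)); last by ring.
by rewrite mulr_ge0 ?sqr_ge0 //; lra.
Qed.

(** Write g = m + h with m the mean over cosets of H.  In the expansion of the product of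
    the three factors every term that is linear or quadratic in h sums to zero,
    since two points of a progression in H are independent.  The cubic term is
    at least minus the sum of the cubes of |h|, and that sum is at most the
    increase of the mean cube from m to g (cube_norm_le). *)
Lemma ap_sum_convex g : (forall x, 0 <= g x) ->
  #|H|%:R * (2 * \sum_x coset_mean H g x ^+ 3 - \sum_x g x ^+ 3) <= ap_sum H g.
Proof.
move=> g0; pose m := coset_mean H g; pose h x := g x - m x.
have H_gt0 : 0 < #|H|%:R :> K by rewrite ltr0n (card_subgroup_gt0 H_zmod).
have m0 x : 0 <= m x by rewrite divr_ge0 ?sumr_ge0 ?ler0n.
have mD x d : d \in H -> m (x + d) = m x by apply: coset_mean_invariant.
have sum_shift (u : V -> K) :
    \sum_x \sum_(d in H) u (x + d) = #|H|%:R * \sum_x u x.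
  rewrite exchange_big mulr_natl -sumr_const /=; apply: eq_bigr => d _.
  by rewrite [RHS](reindex_inj (addIr d)).
have sum_double (u : V -> K) : \sum_(d in H) u (d *+ 2) = \sum_(d in H) u d.
  rewrite [RHS](reindex_inj double_inj) /=.
  by apply: eq_bigl => d; rewrite double_mem.
have sum_h x : \sum_(d in H) h (x + d) = 0.
  rewrite sumrB (eq_bigr (fun=> m x) (F1 := fun d => m (x + d))); last first.
    by move=> d Hd; rewrite mD.
  by rewrite sumr_const -mulr_natl /m /coset_mean mulrC divfK ?subrr ?gt_eqF.
have sum_mh (u : V -> K) : (forall x d, d \in H -> u (x + d) = u x) ->
    \sum_x u x * h x = 0.
  move=> uD; apply: (mulfI (lt0r_neq0 H_gt0)); rewrite mulr0 -sum_shift.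
  rewrite big1 // => x _; rewrite (eq_bigr (fun d => u x * h (x + d))).
    by rewrite -mulr_sumr sum_h mulr0.
  by move=> d Hd; rewrite uD.
have apE : ap_sum H g = #|H|%:R * (\sum_x m x ^+ 3)
    + \sum_x \sum_(d in H) h x * h (x + d) * h (x + d *+ 2).
  have expand x : \sum_(d in H) g x * g (x + d) * g (x + d *+ 2) =
     #|H|%:R * m x ^+ 3 + #|H|%:R * (m x ^+ 2 * h x)
     + \sum_(d in H) m x * h (x + d) * h (x + d *+ 2)
     + \sum_(d in H) h x * h (x + d) * h (x + d *+ 2).
    transitivity (\sum_(d in H) (m x ^+ 3 + m x ^+ 2 * h x
       + (m x ^+ 2 + m x * h x) * h (x + d)
       + (m x ^+ 2 + m x * h x) * h (x + d *+ 2)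
       + m x * h (x + d) * h (x + d *+ 2)
       + h x * h (x + d) * h (x + d *+ 2))).
      apply: eq_bigr => d Hd; have Hd2 : d *+ 2 \in H by rewrite double_mem.
      have gE y : g y = m y + h y by rewrite /h addrC subrK.
      rewrite !gE (mD _ _ Hd) (mD _ _ Hd2); ring.
    rewrite !big_split /= !sumr_const -!mulr_sumr sum_h.
    rewrite (sum_double (fun d => h (x + d))) sum_h.
    by rewrite -(mulr_natl (m x ^+ 3)) -(mulr_natl (_ * h x)) !mulr0 !addr0.
  rewrite /ap_sum (eq_bigr _ (fun x _ => expand x)) !big_split /=.
  rewrite -!mulr_sumr (sum_mh (fun x => m x ^+ 2)); last by move=> x d /mD ->.
  suff -> : \sum_x \sum_(d in H) m x * h (x + d) * h (x + d *+ 2) = 0.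
    by rewrite mulr0 !addr0.
  transitivity (\sum_x \sum_(d in H) m x * h x * h (x + d)).
    rewrite exchange_big [RHS]exchange_big /=; apply: eq_bigr => d Hd.
    rewrite [RHS](reindex_inj (addIr d)); apply: eq_bigr => x _.
    by rewrite mD // -addrA -mulr2n.
  by rewrite big1 // => x _; rewrite -mulr_sumr sum_h mulr0.
have cubeE : \sum_x `|h x| ^+ 3 <= \sum_x g x ^+ 3 - \sum_x m x ^+ 3.
  have sum0 : \sum_x 3 * (m x ^+ 2 * h x) = 0.
    by rewrite -mulr_sumr (sum_mh (fun x => m x ^+ 2)) ?mulr0 // => x d /mD ->.
  rewrite -[leRHS]subr0 -[X in _ <= _ - X]sum0 -!sumrB; apply: ler_sum => x _.
  have gE : g x = m x + h x by rewrite /h addrC subrK.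
  apply: le_trans (cube_norm_le (m0 x) _) _; first by rewrite -gE.
  by rewrite gE le_eqVlt; apply/orP; left; apply/eqP; ring.
have tripleE : - (\sum_x \sum_(d in H) h x * h (x + d) * h (x + d *+ 2))
    <= #|H|%:R * \sum_x `|h x| ^+ 3.
  rewrite -sumrN; apply: le_trans (_ : \sum_x \sum_(d in H)
    (`|h x| ^+ 3 + `|h (x + d)| ^+ 3 + `|h (x + d *+ 2)| ^+ 3) / 3 <= _).
    apply: ler_sum => x _; rewrite -sumrN; apply: ler_sum => d _.
    exact: amgm3_norm.
  under eq_bigr => x _ do rewrite -mulr_suml !big_split
    (sum_double (fun d => `|h (x + d)| ^+ 3)) sumr_const.
  rewrite -mulr_suml !big_split /=. 
  rewrite sumrMnl -[_ *+ #|H|]mulr_natl.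
  rewrite !(sum_shift (fun x => `|h x| ^+ 3)) le_eqVlt.
  by apply/orP; left; apply/eqP; field.
rewrite apE -/m; move: tripleE (ler_wpM2l (ltW H_gt0) cubeE).
rewrite !mulrBr; lra.
Qed.
End Convexity.

(** * The mean cube increment *)

Section Increment.
Variables (p : nat) (p_pr : prime p) (p_odd : odd p) (n : nat).
Local Notation V := 'rV['F_p]_n.
Implicit Types (Xi : {set V}) (d : V).
Variable A : {set V}.

Definition indic (x : V) : rat := (x \in A)%:R.
Definition ap_set d : {set V} := [set x | [&& x \in A, x + d \in A & x + d *+ 2 \in A]].
(** The mean cube density b(H) for H = perp Xi. *)
Definition mean_cube Xi : rat :=
  (\sum_x coset_mean (perp Xi) indic x ^+ 3) / (p ^ n)%:R.

Lemma indic01 x : 0 <= indic x <= 1.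
Proof. by rewrite /indic; case: (_ \in _). Qed.

Lemma pn_gt0 : 0 < (p ^ n)%:R :> rat.
Proof. by rewrite ltr0n expn_gt0 prime_gt0. Qed.

Lemma ap_sum_indic (H : {set V}) :
  ap_sum H indic = \sum_(d in H) #|ap_set d|%:R.
Proof.
rewrite /ap_sum exchange_big; apply: eq_bigr => d _ /=.
rewrite -sum1_card natr_sum [RHS]big_mkcond /=; apply: eq_bigr => x _.
by rewrite inE /indic; do 3!case: (_ \in A).
Qed.

Lemma perp_double Xi d : (d *+ 2 \in perp Xi) = (d \in perp Xi).
Proof.
apply/perpP/perpP => H xi /H; rewrite -scaler_nat dotZl.
  by move/eqP; rewrite mulf_eq0 (negPf (two_neq0 p_pr p_odd)) => /eqP.
by move->; rewrite mulr0.
Qed.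

Lemma double_inj : injective (fun d : V => d *+ 2).
Proof.
move=> x y; rewrite /= -!scaler_nat; apply: scalerI.
exact: (two_neq0 p_pr p_odd).
Qed.

Lemma coset_mean_tower (H H' : {set V}) (g : V -> rat) :
    zmod_closed H -> zmod_closed H' -> H' \subset H ->
  coset_mean H (coset_mean H' g) =1 coset_mean H g.
Proof.
move=> H_zmod H'_zmod sub x.
have H'_gt0 : #|H'|%:R != 0 :> rat by rewrite pnatr_eq0 -lt0n (card_subgroup_gt0 H'_zmod).
rewrite {1}/coset_mean -mulr_suml exchange_big /=.
transitivity ((\sum_(h' in H') coset_mean H g x) / #|H'|%:R).
  rewrite !mulr_suml; apply: eq_bigr => h' Hh'.
  rewrite -(coset_mean_invariant H_zmod g x (subsetP sub _ Hh')) /coset_mean mulrAC.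
  by congr (_ / _ / _); apply: eq_bigr => h _; rewrite addrAC.
by rewrite sumr_const -[X in X / _]mulr_natr mulfK.
Qed.

Lemma mean_cube_set0 : mean_cube set0 = (#|A|%:R / (p ^ n)%:R) ^+ 3.
Proof.
rewrite /mean_cube perp_set0.
rewrite (eq_bigr (fun=> (#|A|%:R / (p ^ n)%:R) ^+ 3)).
  by rewrite sumr_const card_rV // -[X in X / _ = _]mulr_natr mulfK ?gt_eqF ?pn_gt0.
move=> x _; rewrite /coset_mean cardsT card_rV //; congr ((_ / _) ^+ 3).
rewrite -sum1_card natr_sum [RHS]big_mkcond [RHS](reindex_inj (addrI x)) /=.
by apply: eq_big => [h|h _]; rewrite ?inE // /indic; case: (_ \in A).
Qed.

Lemma mean_cube_le1 Xi : mean_cube Xi <= 1.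
Proof.
rewrite ler_pdivrMr ?pn_gt0 // mul1r -card_rV // -sumr_const ler_sum // => x _.
have H_gt0 : 0 < #|perp Xi|%:R :> rat.
  by rewrite ltr0n; apply: card_subgroup_gt0; exact: perp_zmod.
rewrite exprn_ile1 // /coset_mean.
  by rewrite divr_ge0 ?ler0n ?sumr_ge0 // => h _; case/andP: (indic01 (x + h)).
rewrite ler_pdivrMr // mul1r -sumr_const ler_sum // => h _.
by case/andP: (indic01 (x + h)).
Qed.

(** The term d = 0 of the progression count costs at most 2 / #|H| <= 1 / (4K), the
    regularity lemma another 1 / (4K), and the remaining 1 / (2K) of the
    hypothesis is the gain; ap_sum_convex turns it into a growth of the mean cube. *)
Lemma mean_cube_increment (K : nat) Xi (alpha := #|A|%:R / (p ^ n)%:R) :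
    (0 < K)%N -> (8 * K * p ^ #|Xi| <= p ^ n)%N ->
    (forall d, d != 0 -> #|ap_set d|%:R <= (alpha ^+ 3 - K%:R^-1) * (p ^ n)%:R) ->
  exists2 Xi' : {set V}, (#|Xi'| <= #|Xi| + 64 * K ^ 2 * p ^ (2 * #|Xi|))%N &
    2 * (mean_cube Xi - alpha ^+ 3) + K%:R^-1 / 2 <= mean_cube Xi' - alpha ^+ 3.
Proof.
move=> K_gt0 n_large few.
have K4_gt0 : (0 < 4 * K)%N by rewrite muln_gt0.
have [Xi' [sub cardXi' reg]] := regularity p_pr p_odd Xi indic01 K4_gt0.
exists Xi'; first by move: cardXi'; rewrite expnMn mulnA.
move: reg; set H := perp Xi; set g := coset_mean _ _ => reg.
have H_zmod : zmod_closed H := perp_zmod _.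
have g0 x : 0 <= g x.
  by rewrite divr_ge0 ?ler0n ?sumr_ge0 // => h _; case/andP: (indic01 (x + h)).
have := ap_sum_convex H_zmod double_inj (perp_double Xi) g0.
have -> : \sum_x coset_mean H g x ^+ 3 = mean_cube Xi * (p ^ n)%:R.
  rewrite divfK ?gt_eqF ?pn_gt0 //; apply: eq_bigr => x _.
  by rewrite /g coset_mean_tower ?perpS //; exact: perp_zmod.
have -> : \sum_x g x ^+ 3 = mean_cube Xi' * (p ^ n)%:R.
  by rewrite divfK ?gt_eqF ?pn_gt0.
have H_large : (8 * K)%:R <= #|H|%:R :> rat.
  rewrite ler_nat -(@leq_pmul2r (p ^ #|Xi|)) ?expn_gt0 ?prime_gt0 //.
  by rewrite (leq_trans n_large) // mulnC card_perp.
have alpha1 : 0 <= alpha <= 1.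
  rewrite divr_ge0 ?ler0n //= ler_pdivrMr ?pn_gt0 // mul1r ler_nat.
  by rewrite -card_rV // max_card.
have ap_le : ap_sum H indic <=
    (p ^ n)%:R * (#|H|%:R * (alpha ^+ 3 - K%:R^-1) + 2).
  rewrite ap_sum_indic (bigD1 0) /=; last exact: subgroup0.
  apply: le_trans (lerD (_ : _ <= (p ^ n)%:R) (ler_sum _ (_ : forall d, _ ->
    _ <= (alpha ^+ 3 - K%:R^-1) * (p ^ n)%:R))) _.
  - by rewrite ler_nat -card_rV // max_card.
  - by move=> d /andP[_]; exact: few.
  rewrite sumr_const (_ : #|_| = #|H :\ 0|); last first.
    by apply: eq_card => d; rewrite in_setD1 andbC unfold_in.
  have -> : #|H|%:R = 1 + #|H :\ 0|%:R :> rat.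
    by rewrite (cardsD1 0 H) (subgroup0 H_zmod) natrD.
  have K1 : K%:R^-1 <= 1 :> rat by rewrite invf_le1 ?ltr0n // ler1n.
  have a3 : 0 <= alpha ^+ 3 by rewrite exprn_ge0; case/andP: alpha1.
  rewrite -[_ *+ _]mulr_natr -subr_ge0.
  rewrite (_ : _ - _ = (p ^ n)%:R * (alpha ^+ 3 + (1 - K%:R^-1))); last by ring.
  by rewrite mulr_ge0 ?ler0n // addr_ge0 // subr_ge0.
have KE : (4 * K)%:R^-1 = K%:R^-1 / 4 :> rat by rewrite natrM invfM mulrC.
rewrite KE in reg.
have Hpn0 : 0 < (p ^ n)%:R * #|H|%:R :> rat.
  by rewrite mulr_gt0 ?pn_gt0 // (lt_le_trans _ H_large) // ltr0n muln_gt0.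
have two_le : 2 <= #|H|%:R * (K%:R^-1 / 4) :> rat.
  rewrite -subr_ge0 (_ : _ - _ = (#|H|%:R - (8 * K)%:R) * (K%:R^-1 / 4)).
    by rewrite mulr_ge0 ?subr_ge0 // divr_ge0 ?invr_ge0 ?ler0n.
  by rewrite natrM; field; rewrite pnatr_eq0 -lt0n.
move: reg; rewrite ler_norml => /andP[reg _] conv.
rewrite -(ler_pM2l Hpn0).
have := ler_wpM2l (ler0n _ (p ^ n)) two_le.
move: reg conv ap_le two_le Hpn0; rewrite /alpha.
move: (ap_sum H g) (ap_sum H indic) (#|H|%:R : rat) (K%:R^-1 : rat).
move: (mean_cube Xi) (mean_cube Xi') (#|A|%:R / _ : rat) => b b' al.
move: ((p ^ n)%:R : rat) => P.
move=> S S' h k reg conv ap_le two_le Hpn0 two_le'. nra.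
Qed.
End Increment.

(** * Towers and the upper bound *)

(** The number of equations after i applications of mean_cube_increment. *)
Definition codim_bound (p K i : nat) : nat :=
  iter i (fun c => c + 64 * K ^ 2 * p ^ (2 * c))%N 0%N.

Lemma tower_gt p h : (1 < p)%N -> (h < tower p h)%N.
Proof.
move=> p_gt1; elim: h => //= h IHh.
by apply: leq_ltn_trans IHh _; apply: ltn_expl.
Qed.

Lemma tower_le p h h' : (1 < p)%N -> (h <= h')%N -> (tower p h <= tower p h')%N.
Proof.
move=> p1 hh'; rewrite -(subnK hh'); elim: (h' - h)%N => // m IHm.
by rewrite addSn; apply: leq_trans IHm (ltnW (ltn_expl _ p1)).
Qed.

(** The summand k on the left absorbs both the factor 128 K ^ 2 and the lower order terms,
    so that a step costs exactly one level of the tower. *)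
Lemma codim_bound_tower p K k i : (1 < p)%N -> (128 * K ^ 2 <= 2 ^ k)%N ->
  (2 * codim_bound p K i + k < tower p (i + k))%N.
Proof.
move=> p_gt1 Kk; elim: i => [|i IHi]; first exact: tower_gt.
have pk : (128 * K ^ 2 <= p ^ k)%N.
  by apply: leq_trans Kk _; case: (k) => // k'; rewrite leq_exp2r.
rewrite addSn /= -/(codim_bound p K i); set c := codim_bound p K i in IHi *.
have lt1 := ltn_expl (2 * c + k) p_gt1.
have lt2 : (128 * K ^ 2 * p ^ (2 * c) <= p ^ (2 * c + k))%N.
  by rewrite expnD mulnC leq_mul2l pk orbT.
have lt3 : (2 * p ^ (2 * c + k) <= p ^ tower p (i + k))%N.
  apply: leq_trans (_ : p ^ (2 * c + k).+1 <= _)%N.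
    by rewrite expnS leq_mul2r p_gt1 orbT.
  by rewrite leq_exp2l.
lia.
Qed.

Section Upper.
Variables (p : nat) (p_pr : prime p) (p_odd : odd p) (n : nat).
Local Notation V := 'rV['F_p]_n.

(** The recursion x -> 2 x + 1 / (2K) started at 0. *)
Lemma mean_cube_iterate (A : {set V}) (K i : nat) (alpha := #|A|%:R / (p ^ n)%:R) :
    (0 < K)%N -> (forall j, (j < i)%N -> 8 * K * p ^ codim_bound p K j <= p ^ n)%N ->
    (forall d, d != 0 -> #|ap_set A d|%:R <= (alpha ^+ 3 - K%:R^-1) * (p ^ n)%:R) ->
  exists2 Xi : {set V}, (#|Xi| <= codim_bound p K i)%N &
    (2 ^ i - 1)%N%:R * (K%:R^-1 / 2) <= mean_cube A Xi - alpha ^+ 3.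
Proof.
move=> K_gt0 + few; elim: i => [|i IHi] large.
  by exists set0; rewrite ?cards0 // mean_cube_set0 // subrr mul0r.
have [j ji|Xi cardXi bXi] := IHi; first by rewrite large // ltnW.
have [|Xi' cardXi' bXi'] := mean_cube_increment p_pr p_odd (Xi := Xi) K_gt0 _ few.
  apply: leq_trans (large i _) => //.
  by rewrite leq_mul2l leq_exp2l ?prime_gt1 // cardXi orbT.
exists Xi'.
  apply: leq_trans cardXi' _; rewrite leq_add // leq_mul2l leq_exp2l ?prime_gt1 //.
  by rewrite leq_mul2l cardXi !orbT.
apply: le_trans bXi'; rewrite expnS -/alpha.
have -> : (2 * 2 ^ i - 1)%N%:R = 2 * (2 ^ i - 1)%N%:R + 1 :> rat.
  by rewrite -natrM natr1; congr _%:R; have := expn_gt0 2 i; lia.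
by rewrite mulrDl mul1r -mulrA lerD2r ler_wpM2l.
Qed.

(** Stated without division, so that it can be transported to any field. *)
Lemma popular_difference_tower (A : {set V}) (K k i : nat) :
    (0 < K)%N -> (128 * K ^ 2 <= 2 ^ k)%N -> (2 * K + 1 < 2 ^ i)%N ->
    (tower p (i + k) <= n)%N ->
  exists2 d : V, d != 0 &
    (K * #|A| ^ 3 <= K * #|ap_set A d| * (p ^ n) ^ 2 + (p ^ n) ^ 3)%N.
Proof.
move=> K_gt0 Kk Ki n_large; have p1 := prime_gt1 p_pr.
case: (pickP (fun d : V => (d != 0) && (K * #|A| ^ 3
     <= K * #|ap_set A d| * (p ^ n) ^ 2 + (p ^ n) ^ 3)%N)) => [d|none].
  by case/andP => d0 dA; exists d.
have [j ji|d d0|Xi _] := @mean_cube_iterate A K i K_gt0.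
- apply: leq_trans (_ : p ^ (k + codim_bound p K j) <= _)%N.
    rewrite expnD leq_mul2r; apply/orP; right.
    apply: leq_trans (_ : 2 ^ k <= _)%N; first by nia.
    by case: (k) => // k'; rewrite leq_exp2r.
  rewrite leq_exp2l //; apply: leq_trans n_large.
  have := codim_bound_tower j p1 Kk.
  have : (tower p (j + k) <= tower p (i + k))%N.
    by apply: tower_le => //; rewrite leq_add2r ltnW.
  by lia.
- have := none d; rewrite d0 /= => /negbT; rewrite -ltnNge => lt_ap.
  have P_gt0 := pn_gt0 p_pr n; have K0 : 0 < K%:R :> rat by rewrite ltr0n.
  rewrite -(ler_pM2l (mulr_gt0 K0 (exprn_gt0 2 P_gt0))) -subr_ge0.
  rewrite (_ : _ - _ = K%:R * #|A|%:R ^+ 3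
     - (K%:R * #|ap_set A d|%:R * (p ^ n)%:R ^+ 2 + (p ^ n)%:R ^+ 3)).
    by rewrite subr_ge0 -!natrX -!natrM -natrD ler_nat ltnW.
  by field; rewrite !pnatr_eq0 -!lt0n K_gt0 expn_gt0 ltnW.
move=> bXi; exfalso; have := mean_cube_le1 p_pr A Xi.
have : 1 < (2 ^ i - 1)%N%:R * (K%:R^-1 / 2) :> rat.
  rewrite mulrA ltr_pdivlMr // mul1r ltr_pdivlMr ?ltr0n //.
  by rewrite -natrM ltr_nat; lia.
have : 0 <= (#|A|%:R / (p ^ n)%:R) ^+ 3 :> rat by rewrite exprn_ge0 // divr_ge0 ?ler0n.
lra.
Qed.
End Upper.

(** * Progressions outside an interval *)

Section Interval.
Variables (p : nat) (p_pr : prime p) (p_odd : odd p).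
Variable K : realFieldType.
Implicit Types (t e : 'F_p).

(** About p / 4; what matters is that gap / p stays between 1/5 and 1/3 for all odd
    primes, including the smallest ones. *)
Definition gap : nat := p.+1 %/ 4.
Definition base_density : K := 1 - gap%:R / p%:R.
Local Notation alpha := base_density.
Definition outside_gap t : K := (gap <= t)%N%:R.
Definition outside_gap_ap e : K :=
  (\sum_t outside_gap t * outside_gap (t + e) * outside_gap (t + e *+ 2)) / p%:R.

Lemma gap_ge : (p <= 5 * gap)%N.
Proof.
rewrite /gap; have := prime_gt1 p_pr.
have : p != 9 by apply: contraTneq p_pr => ->.
by move: p_odd; lia.
Qed.

Lemma gap_le : (3 * gap <= p)%N.
Proof. by rewrite /gap; have := odd_prime_gt2 p_odd p_pr; lia. Qed.

Lemma sum_initial_interval (m : nat) : (m <= p)%N -> \sum_(t : 'F_p) (t < m)%N%:R = m%:R :> K.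
Proof.
move=> m_le; rewrite -(big_mkord xpredT (fun i => (i < m)%N%:R)) Fp_cast //.
rewrite (big_cat_nat (n := m)) //= big_nat (eq_bigr (fun=> 1)) => [|i /andP[_ ->]] //.
rewrite -big_nat sumr_const_nat subn0 big_nat big1 ?addr0 // => i /andP[mi _].
by rewrite ltnNge mi.
Qed.

Lemma sum_outside_gap : \sum_t outside_gap t = p%:R * alpha.
Proof.
rewrite (eq_bigr (fun t => 1 - (t < gap)%N%:R)) => [|t _]; last first.
  by rewrite /outside_gap leqNgt; case: (_ < _)%N; rewrite ?subrr ?subr0.
rewrite sumrB sumr_const sum_initial_interval; last by have := gap_le; lia.
have -> : #|'F_p| = p by rewrite card_Fp.
by rewrite /base_density mulrBr mulr1 mulrCA divff ?mulr1 // pnatr_eq0 -lt0n prime_gt0.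
Qed.

Lemma outside_gap01 t : 0 <= outside_gap t <= 1.
Proof. by rewrite /outside_gap; case: leqP; rewrite lexx ler01. Qed.

Lemma outside_gap_ap01 e : 0 <= outside_gap_ap e <= 1.
Proof.
have chi0 t : 0 <= outside_gap t by case/andP: (outside_gap01 t).
have chi1 t : outside_gap t <= 1 by case/andP: (outside_gap01 t).
have p_gt0 : 0 < p%:R :> K by rewrite ltr0n prime_gt0.
rewrite divr_ge0 ?ler0n ?sumr_ge0 //=; last by move=> t _; rewrite !mulr_ge0.
rewrite ler_pdivrMr // mul1r -[X in X%:R](card_Fp p_pr) -sumr_const ler_sum // => t _.
by rewrite !mulr_ile1 // mulr_ge0.
Qed.

Lemma base_density_bounds : 2 / 3 <= alpha <= 4 / 5.
Proof.
have p_gt0 : 0 < p%:R :> K by rewrite ltr0n prime_gt0.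
have lo : p%:R <= 5 * gap%:R :> K by rewrite -natrM ler_nat gap_ge.
have hi : 3 * gap%:R <= p%:R :> K by rewrite -natrM ler_nat gap_le.
rewrite /base_density; have : 1 / 5 <= gap%:R / p%:R :> K by rewrite ler_pdivlMr //; lra.
have : gap%:R / p%:R <= 1 / 3 :> K by rewrite ler_pdivrMr //; lra.
lra.
Qed.

Let b t : K := (t < gap)%N%:R.

(** In F_p the midpoint of two elements of an initial interval with the same parity is
    their midpoint as integers. *)
Lemma half_below (t s x : 'F_p) : odd t = odd s -> x *+ 2 = t + s ->
  b t * b s <= b t * b x * b s.
Proof.
rewrite /b => ts; case: ltnP => [lt_t|_]; last by rewrite !mul0r.
case: ltnP => [lt_s|_]; last by rewrite !mulr0.
move=> xE; suff -> : x = ((t + s)./2)%:R :> 'F_p.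
  rewrite val_Fp_nat // modn_small; last by have := gap_le; lia.
  by rewrite (_ : (_ < gap)%N = true) ?mulr1 //; lia.
have two0 := two_neq0 p_pr p_odd; apply: (mulIf two0).
rewrite -natrM mulr_natr xE -{1}[t]natr_Zp -{1}[s]natr_Zp -natrD.
by congr _%:R; lia.
Qed.

(** Endpoints of the same parity have their midpoint in the interval, and at least half
    of all pairs have the same parity.  This is more than the cube of the density
    predicts, as long as the density is below one half. *)
Lemma interval_ap_count : gap%:R ^+ 2 / 2 <= \sum_e \sum_t b t * b (t + e) * b (t + e *+ 2).
Proof.
rewrite exchange_big /=.
have two0 := two_neq0 p_pr p_odd.
have step t : \sum_e b t * b (t + e) * b (t + e *+ 2)
    >= \sum_(s : 'F_p) (odd t == odd s)%:R * (b t * b s).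
  have bij : injective (fun s : 'F_p => (s - t) / 2).
    by move=> s s' /(mulIf _) /= e; apply: (addIr (- t)); apply: e; rewrite invr_eq0.
  rewrite [leRHS](reindex_inj bij) /=; apply: ler_sum => s _.
  have -> : t + (s - t) / 2 *+ 2 = s.
    by rewrite -mulr_natr divfK // addrC subrK.
  case: eqP => [ts|_]; last by rewrite mul0r !mulr_ge0 ?ler0n.
  rewrite mul1r; apply: half_below => //.
  by rewrite mulrnDl -[_ / 2 *+ 2]mulr_natr divfK // mulr2n -addrA subrKC.
apply: le_trans (ler_sum _ (fun t _ => step t)).
pose S c := \sum_(t : 'F_p) (odd t == c)%:R * b t.
have -> : \sum_(t : 'F_p) \sum_(s : 'F_p) (odd t == odd s)%:R * (b t * b s)
    = S true ^+ 2 + S false ^+ 2.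
  rewrite /S !expr2 !big_distrlr -big_split /=; apply: eq_bigr => t _.
  rewrite -big_split /=; apply: eq_bigr => s _.
  by case: (odd t); case: (odd s) => /=; ring.
have -> : gap%:R = S true + S false.
  rewrite -sum_initial_interval -?big_split /=; last by have := gap_le; lia.
  by apply: eq_bigr => t _; case: (odd t) => /=; ring.
have := sqr_ge0 (S true - S false); lra.
Qed.

(** By inclusion-exclusion, the progressions in a set and those in its complement
    determine each other: an excess of progressions in the interval is a deficit
    in the complement. *)
Lemma sum_outside_gap_ap : \sum_e outside_gap_ap e <= p%:R * (alpha ^+ 3 - 150^-1).
Proof.
have p_gt0 : 0 < p%:R :> K by rewrite ltr0n prime_gt0.
have two0 := two_neq0 p_pr p_odd.
have sb : \sum_t b t = gap%:R by rewrite sum_initial_interval //; have := gap_le; lia.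
have sum2 (u : 'F_p -> K) : \sum_e u (e *+ 2) = \sum_e u e.
  rewrite [RHS](reindex_inj (mulIf two0)) /=.
  by apply: eq_bigr => e _; rewrite mulr_natr.
have shift (u : 'F_p -> K) t : \sum_e u (t + e) = \sum_e u e.
  by rewrite [RHS](reindex_inj (addrI t)).
have -> : \sum_e outside_gap_ap e = (p%:R ^+ 2 - 3 * p%:R * gap%:R + 3 * gap%:R ^+ 2
   - \sum_e \sum_t b t * b (t + e) * b (t + e *+ 2)) / p%:R.
  rewrite /outside_gap_ap -mulr_suml; congr (_ / _).
  rewrite exchange_big [X in _ - X]exchange_big /=.
  transitivity (\sum_t (p%:R - p%:R * b t - 2 * gap%:R + 2 * gap%:R * b t
      + \sum_e b (t + e) * b (t + e *+ 2)
      - \sum_e b t * b (t + e) * b (t + e *+ 2))).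
    apply: eq_bigr => t _.
    transitivity (\sum_e (1 - b t - b (t + e) - b (t + e *+ 2) + b t * b (t + e)
       + b t * b (t + e *+ 2) + b (t + e) * b (t + e *+ 2)
       - b t * b (t + e) * b (t + e *+ 2))).
      apply: eq_bigr => e _.
      have cE s : outside_gap s = 1 - b s.
        by rewrite /outside_gap /b leqNgt; case: (_ < _)%N; rewrite ?subrr ?subr0.
      rewrite !cE; ring.
    rewrite !(sumrB, big_split) /= -!mulr_sumr.
    rewrite !(sum2 (fun e => b (t + e))) !shift sb !sumr_const.
    have -> : #|'F_p| = p by rewrite card_Fp.
    by rewrite -[b t *+ _]mulr_natl; ring.
  rewrite !(sumrB, big_split) /= !sumr_const -!mulr_sumr sb.
  have -> : #|'F_p| = p by rewrite card_Fp.
  have -> : \sum_t \sum_e b (t + e) * b (t + e *+ 2) = gap%:R ^+ 2.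
    rewrite exchange_big /= (eq_bigr (fun e => \sum_t b t * b (t + e))).
      rewrite exchange_big /=.
      under eq_bigr do rewrite -mulr_sumr shift sb.
      by rewrite -mulr_suml sb.
    move=> e _; rewrite [RHS](reindex_inj (addIr e)); apply: eq_bigr => t _.
    by rewrite -addrA -mulr2n.
  ring.
have := interval_ap_count; set Q := \sum_e _ => leQ.
rewrite ler_pdivrMr //.
have [lo hi] := andP base_density_bounds.
have aE : gap%:R = p%:R * (1 - alpha) :> K.
  by rewrite /base_density opprB addrC subrK mulrCA divff ?mulr1 ?gt_eqF.
move: leQ; rewrite aE => leQ.
rewrite -subr_ge0; apply: (@le_trans _ _ (p%:R ^+ 2 *
   ((1 - alpha) ^+ 2 * (1 / 2 - (1 - alpha)) - 150^-1))).
  rewrite mulr_ge0 ?sqr_ge0 // subr_ge0.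
  rewrite (_ : 150^-1 = (1 / 5) ^+ 2 * (1 / 6)); last by field.
  by apply: ler_pM; rewrite ?sqr_ge0 ?lerXn2r ?nnegrE; lra.
by lra.
Qed.
End Interval.

(** * Equidistribution along independent directions *)

Section Equidistribution.
Variables (p : nat) (p_pr : prime p) (m : nat).
Local Notation W := 'rV['F_p]_m.
Variable K : fieldType.
Implicit Types (v y : W) (G : 'F_p -> K).

Definition independent3 v0 v1 v2 := forall a0 a1 a2 : 'F_p,
  a0 *: v0 + a1 *: v1 + a2 *: v2 = 0 -> [/\ a0 = 0, a1 = 0 & a2 = 0].

Lemma dual_basis3 v0 v1 v2 : independent3 v0 v1 v2 ->
  exists y0 y1 y2 : W,
    [/\ [/\ dot y0 v0 = 1, dot y0 v1 = 0 & dot y0 v2 = 0],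
        [/\ dot y1 v0 = 0, dot y1 v1 = 1 & dot y1 v2 = 0]
      & [/\ dot y2 v0 = 0, dot y2 v1 = 0 & dot y2 v2 = 1]].
Proof.
move=> indep; pose r (i : 'I_3) := nth 0 [:: v0; v1; v2] i.
pose o1 : 'I_3 := lift ord0 ord0; pose o2 : 'I_3 := lift ord0 (lift ord0 ord0).
pose M := \matrix_i r i.
have /row_freeP[N MN] : row_free M.
  apply: inj_row_free => u uM.
  have [|u0 u1 u2] := indep (u 0 ord0) (u 0 o1) (u 0 o2).
    have := uM; rewrite mulmx_sum_row !big_ord_recl big_ord0 addr0 !rowK.
    by rewrite addrA.
  apply/rowP => i; rewrite mxE; case: i => [[|[|[|//]]] lt].
  - by rewrite -[RHS]u0; congr (u _ _); apply: val_inj.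
  - by rewrite -[RHS]u1; congr (u _ _); apply: val_inj.
  - by rewrite -[RHS]u2; congr (u _ _); apply: val_inj.
have MNE i j : dot (col i N)^T (r j) = (i == j)%:R.
  rewrite dotC /dot trmxK -[r j]rowK -/M.
  have := congr1 (fun A : 'M_3 => A j i) MN.
  by rewrite !mxE eq_sym => <-; apply: eq_bigr => k _; rewrite !mxE.
exists (col ord0 N)^T, (col o1 N)^T, (col o2 N)^T.
by do 2?split;
  [exact: (MNE _ ord0)|exact: (MNE _ o1)|exact: (MNE _ o2)
  |exact: (MNE _ ord0)|exact: (MNE _ o1)|exact: (MNE _ o2)
  |exact: (MNE _ ord0)|exact: (MNE _ o1)|exact: (MNE _ o2)].
Qed.

(** Shifting y along a dual basis shifts the three products independently. *)
Lemma equidistribution3 v0 v1 v2 G0 G1 G2 : independent3 v0 v1 v2 ->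
  (\sum_y G0 (dot y v0) * G1 (dot y v1) * G2 (dot y v2)) * p%:R ^+ 3
  = (p ^ m)%:R * ((\sum_t G0 t) * (\sum_t G1 t) * (\sum_t G2 t)).
Proof.
case/dual_basis3 => y0 [y1 [y2 [[e00 e01 e02] [e10 e11 e12] [e20 e21 e22]]]]; set S := \sum_z _.
have SE t0 t1 t2 : S = \sum_z G0 (dot z v0 + t0) * G1 (dot z v1 + t1) * G2 (dot z v2 + t2).
  rewrite /S (reindex_inj (addIr (t0 *: y0 + t1 *: y1 + t2 *: y2))) /=.
  apply: eq_bigr => z _; rewrite !dotDl !dotZl.
  rewrite e00 e01 e02 e10 e11 e12 e20 e21 e22.
  by rewrite !mulr0 !mulr1 !addr0 !add0r.
have cF : #|'F_p| = p by rewrite card_Fp.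
transitivity (\sum_(t0 : 'F_p) \sum_(t1 : 'F_p) \sum_(t2 : 'F_p) S).
  rewrite !sumr_const cF -(mulr_natr S) -(mulr_natr (S * _)).
  by rewrite -(mulr_natr (S * _ * _)); ring.
rewrite (eq_bigr _ (fun t0 _ => eq_bigr _ (fun t1 _ => eq_bigr _ (fun t2 _ => SE t0 t1 t2)))).
transitivity (\sum_z (\sum_t G0 (dot z v0 + t)) * (\sum_t G1 (dot z v1 + t))
    * (\sum_t G2 (dot z v2 + t))).
  under eq_bigr => t0 _ do under eq_bigr => t1 _ do rewrite exchange_big.
  under eq_bigr => t0 _ do rewrite exchange_big.
  rewrite exchange_big; apply: eq_bigr => z _ /=.
  rewrite big_distrlr mulr_suml; apply: eq_bigr => t0 _.
  rewrite mulr_suml; apply: eq_bigr => t1 _.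
  by rewrite mulr_sumr.
have sh G a : \sum_t G (a + t) = \sum_t G t by rewrite [RHS](reindex_inj (addrI a)).
under eq_bigr do rewrite !sh.
by rewrite sumr_const card_mx card_Fp // mul1n mulr_natl.
Qed.

Lemma equidistribution1 v G : v != 0 ->
  (\sum_y G (dot y v)) * p%:R = (p ^ m)%:R * \sum_t G t.
Proof.
case/dot_nondegenerate => y; rewrite dotC => yv; set S := \sum_z _.
have SE t : S = \sum_z G (dot z v + t).
  rewrite /S (reindex_inj (addIr (t *: y))) /=.
  by apply: eq_bigr => z _; rewrite dotDl dotZl yv mulr1.
transitivity (\sum_(t : 'F_p) S).
  by rewrite sumr_const card_Fp // mulr_natr.
rewrite (eq_bigr _ (fun t _ => SE t)) exchange_big /=.
have sh a : \sum_t G (a + t) = \sum_t G t by rewrite [RHS](reindex_inj (addrI a)).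
under eq_bigr do rewrite sh.
by rewrite sumr_const card_mx card_Fp // mul1n mulr_natl.
Qed.
End Equidistribution.

(** * Counting bad choices of directions *)

Section Exponential.
Variable R : realType.

Lemma expR_le_quadratic (x : R) : 0 <= x <= 1 / 2 -> expR x <= 1 + x + 2 * x ^+ 2.
Proof.
move=> /andP[x0 x1]; have := expR_ge1Dx (- x); rewrite expRN => le_inv.
have e_gt0 := expR_gt0 x.
have {le_inv} : (1 - x) * expR x <= 1 by rewrite -ler_pdivlMr // div1r.
have : 0 <= x * (1 - 2 * x) by rewrite mulr_ge0 //; lra.
move=> h1 h2; rewrite -(ler_pM2l (_ : 0 < 1 - x)); last by lra.
apply: le_trans h2 _; nra.
Qed.
End Exponential.

Section Chernoff.
Variables (p : nat) (p_pr : prime p) (R : realType) (m : nat).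
Local Notation W := 'rV['F_p]_m.
Variables (lam : 'F_p -> R) (mu eta : R).
Hypothesis lam01 : forall e, 0 <= lam e <= 1.
Hypothesis lam_mean : \sum_e lam e <= p%:R * mu.
Hypothesis eta01 : 0 <= eta <= 1.
Variables (V : finType) (Y : {set V}).

(** The exponential moment of one random scalar product, which is uniform on F_p. *)
Lemma expR_mean (d : W) : d != 0 ->
  \sum_w expR (eta / 4 * lam (dot w d))
  <= (p ^ m)%:R * expR (eta / 4 * mu + 2 * (eta / 4) ^+ 2).
Proof.
move=> d0; have p_gt0 : 0 < p%:R :> R by rewrite ltr0n prime_gt0.
rewrite -(ler_pM2r p_gt0) (equidistribution1 p_pr (fun e => expR (eta / 4 * lam e)) d0).
rewrite -[leRHS]mulrA ler_wpM2l ?ler0n // [leRHS]mulrC.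
apply: le_trans (_ : p%:R * (1 + (eta / 4 * mu + 2 * (eta / 4) ^+ 2)) <= _); last first.
  by rewrite ler_wpM2l ?ler0n // expR_ge1Dx.
apply: le_trans (_ : \sum_(e : 'F_p) (1 + 2 * (eta / 4) ^+ 2 + eta / 4 * lam e) <= _).
  apply: ler_sum => e _; have /andP[l0 l1] := lam01 e.
  have /andP[e0 e1] := eta01.
  apply: le_trans (expR_le_quadratic _) _.
    by rewrite mulr_ge0 ?divr_ge0 //=; nra.
  have : lam e ^+ 2 <= 1 by rewrite exprn_ile1.
  have : 0 <= (eta / 4) ^+ 2 by rewrite sqr_ge0.
  rewrite exprMn; nra.
have -> : \sum_(e : 'F_p) (1 + 2 * (eta / 4) ^+ 2 + eta / 4 * lam e)
    = p%:R * (1 + 2 * (eta / 4) ^+ 2) + eta / 4 * \sum_e lam e.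
  by rewrite big_split /= sumr_const card_Fp // -[_ *+ p]mulr_natl mulr_sumr.
have := lam_mean; have /andP[e0 e1] := eta01; nra.
Qed.

Definition heavy (d : W) : {set {ffun V -> W}} :=
  [set v : {ffun V -> W} | (mu + eta) * #|Y|%:R < \sum_(x in Y) lam (dot (v x) d)].

(** Chernoff's bound as a count: Markov's inequality for the exponential of the sum, which
    is a product over x and factorises over all choice functions v. *)
Lemma card_heavy (d : W) : d != 0 ->
  #|heavy d|%:R <= #|{: {ffun V -> W}}|%:R * expR (- (#|Y|%:R * (eta ^+ 2 / 8))).
Proof.
move=> d0; set k : R := #|Y|%:R.
pose g x w := if x \in Y then expR (eta / 4 * lam (dot w d)) else 1.
have g_gt0 x w : 0 < g x w by rewrite /g; case: ifP => _ //; exact: expR_gt0.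
have sum_g : \sum_(v : {ffun V -> W}) \prod_x g x (v x)
   <= #|{: {ffun V -> W}}|%:R * expR (eta / 4 * mu + 2 * (eta / 4) ^+ 2) ^+ #|Y|.
  have cW : #|{: W}| = (p ^ m)%N := card_rV p_pr m.
  rewrite -bigA_distr_bigA /= card_ffun cW [X in X * _]natrX.
  set E := expR _; have -> : (p ^ m)%:R ^+ #|V| * E ^+ #|Y|
      = \prod_(x : V) ((p ^ m)%:R * if x \in Y then E else 1).
    by rewrite big_split /= prodr_const -big_mkcond prodr_const.
  apply: ler_prod => x _; rewrite sumr_ge0 /=; last by move=> w _; exact: ltW.
  rewrite /g; case: (x \in Y); first exact: expR_mean.
  by rewrite sumr_const cW mulr1.
have markov : #|heavy d|%:R * expR (eta / 4 * ((mu + eta) * k))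
    <= \sum_(v : {ffun V -> W}) \prod_x g x (v x).
  rewrite mulr_natl -sumr_const big_mkcond /=; apply: ler_sum => v _.
  have -> : \prod_x g x (v x) = expR (eta / 4 * \sum_(x in Y) lam (dot (v x) d)).
    by rewrite mulr_sumr expR_sum [RHS]big_mkcond.
  rewrite inE; case: ifP => [lt_v|_]; last exact: expR_ge0.
  by rewrite ler_expR ler_wpM2l ?(ltW lt_v) // divr_ge0 //; case/andP: eta01.
have := le_trans markov sum_g; rewrite -ler_pdivlMr ?expR_gt0 //.
move/le_trans; apply; rewrite -[leLHS]mulrA ler_wpM2l ?ler0n //.
rewrite -expRM_natl -expRN -expRD ler_expR le_eqVlt.
by apply/orP; left; apply/eqP; rewrite -/k; field.
Qed.
End Chernoff.

Section Dependent.
Variables (p : nat) (p_pr : prime p) (m : nat).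
Local Notation W := 'rV['F_p]_m.
Variable V : finType.

(** Translating the value at x0 moves v off the relation, injectively. *)
Lemma card_relation (c : V -> 'F_p) x0 : c x0 != 0 ->
  (#|[set v : {ffun V -> W} | (\sum_x c x *: v x == 0)%R]| * p ^ m
    <= #|{: {ffun V -> W}}|)%N.
Proof.
move=> c0; pose shift (vw : {ffun V -> W} * W) : {ffun V -> W} :=
  [ffun x => vw.1 x + (if x == x0 then vw.2 else 0)].
have -> : (p ^ m)%N = #|[set: W]| by rewrite cardsT card_mx card_Fp // mul1n.
rewrite -cardsX -(card_in_imset (f := shift)) ?max_card //.
move=> [v w] [v' w']; rewrite !inE /= !andbT => /eqP vE /eqP v'E e.
have sumE u z : \sum_x c x *: shift (u, z) x = \sum_x c x *: u x + c x0 *: z.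
  under eq_bigr do rewrite ffunE scalerDr.
  rewrite big_split; congr (_ + _); rewrite (bigD1 x0) //= eqxx big1 ?addr0 //.
  by move=> x /negPf ->; rewrite scaler0.
have ww : w = w'.
  apply: (scalerI c0); have := sumE v w.
  by rewrite e sumE v'E vE !add0r.
congr (_, _) => //; apply/ffunP => x; have := congr1 (fun u : {ffun V -> W} => u x) e.
by rewrite /= !ffunE ww => /addIr.
Qed.
End Dependent.

(** * Existence of good directions *)

Lemma indicator_sum_ge1 (K : numDomainType) (I : finType) (P b : pred I) i :
  P i -> b i -> 1 <= \sum_(j | P j) (b j)%:R :> K.
Proof.
move=> Pi bi; rewrite (bigD1 i Pi) /= bi lerDl.
by apply: sumr_ge0 => ? _; exact: ler0n.
Qed.

Section Directions.
Variables (p : nat) (p_pr : prime p) (p_odd : odd p) (R : realType) (n m : nat).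
Local Notation V := 'rV['F_p]_n.
Local Notation W := 'rV['F_p]_m.
Variable (Y : {set V}).
Hypothesis m_large : (2 * n + 5 <= m)%N.
Hypothesis Y_large : 2 ^+ 21 * (p * m)%:R <= #|Y|%:R :> R.

Local Notation relation := (V * V * ('F_p * 'F_p * 'F_p))%type.

Definition dependent (i : relation) : {set {ffun V -> W}} :=
  let: (x, d, (a0, a1, a2)) := i in
  [set v : {ffun V -> W} |
    a0 *: v x + a1 *: v (x + d) + a2 *: v (x + d *+ 2) == 0].

Definition nontrivial_relation (i : relation) := (i.1.2 != 0) && (i.2 != 0).

(** The three points of a nontrivial progression are distinct, so a relation between
    their directions really restricts v. *)
Lemma card_dependent i : nontrivial_relation i ->
  (#|dependent i| * p ^ m <= #|{: {ffun V -> W}}|)%N.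
Proof.
case: i => [[x d] [[a0 a1] a2]] /andP[/= d0 a_neq0].
pose c z : 'F_p := (z == x)%:R * a0 + (z == x + d)%:R * a1 + (z == x + d *+ 2)%:R * a2.
have two0 := two_neq0 p_pr p_odd.
have d20 : d *+ 2 != 0 by rewrite -scaler_nat scaler_eq0 negb_or two0.
have n01 : x != x + d by rewrite -subr_eq0 opprD addrA subrr sub0r oppr_eq0.
have n02 : x != x + d *+ 2 by rewrite -subr_eq0 opprD addrA subrr sub0r oppr_eq0.
have n12 : x + d != x + d *+ 2.
  by rewrite (inj_eq (addrI x)) mulr2n -subr_eq0 opprD addrA subrr sub0r oppr_eq0.
rewrite (_ : [set v | _] = [set v : {ffun V -> W} | \sum_z c z *: v z == 0]); last first.
  apply/setP => v; rewrite !inE; congr (_ == _).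
  have pick z (a : 'F_p) : \sum_y ((y == z)%:R * a) *: v y = a *: v z.
    rewrite (bigD1 z) //= eqxx mul1r big1 ?addr0 // => y /negPf ->.
    by rewrite mul0r scale0r.
  under eq_bigr do rewrite !scalerDl.
  by rewrite !big_split /= !pick.
have [z cz] : exists z, c z != 0.
  have [a0n|a0n] := eqVneq a0 0; last first.
    by exists x; rewrite /c eqxx (negPf n01) (negPf n02) mul1r !mul0r !addr0.
  have [a1n|a1n] := eqVneq a1 0; last first.
    exists (x + d); rewrite /c eqxx (negPf n12) [_ == x]eq_sym (negPf n01).
    by rewrite mul1r !mul0r addr0 add0r.
  exists (x + d *+ 2); rewrite /c eqxx ![x + d *+ 2 == _]eq_sym (negPf n12) (negPf n02).
  rewrite mul1r !mul0r !add0r; apply: contraNneq a_neq0 => a2n.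
  by rewrite a0n a1n a2n.
exact: (card_relation p_pr _ cz).
Qed.

Let All : R := #|{: {ffun V -> W}}|%:R.
Let All_gt0 : 0 < All.
Proof. by rewrite ltr0n; apply/card_gt0P; exists [ffun=> 0]. Qed.

Local Notation heavy := (heavy (@outside_gap_ap p R) (base_density p R ^+ 3 - 150^-1) 300^-1 Y).

Lemma sum_dependent : \sum_(i | nontrivial_relation i) #|dependent i|%:R <= All / 4.
Proof.
have pm_gt0 : 0 < (p ^ m)%:R :> R by rewrite ltr0n expn_gt0 prime_gt0.
apply: le_trans (_ : \sum_(i : relation) All / (p ^ m)%:R <= _).
  rewrite [leLHS]big_mkcond /=; apply: ler_sum => i _.
  case: ifP => [ok|_]; last by rewrite divr_ge0 ?ler0n.
  by rewrite ler_pdivlMr // -natrM ler_nat card_dependent.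
rewrite sumr_const !card_prod !card_mx !card_Fp // !mul1n -[leLHS]mulr_natr -[leLHS]mulrA.
rewrite ler_wpM2l ?ler0n // mulrC ler_pdivrMr // mulrC ler_pdivlMr ?ltr0n //.
rewrite -natrM ler_nat.
apply: leq_trans (_ : p ^ (2 * n + 5) <= _)%N; last first.
  by rewrite leq_exp2l ?prime_gt1.
rewrite (_ : 2 * n + 5 = n + n + (1 + 1 + 1) + 2)%N; last by lia.
rewrite !expnD expn1 leq_mul2l; apply/orP; right.
by have := prime_gt1 p_pr; nia.
Qed.

Lemma sum_heavy : \sum_(d : W | d != 0) #|heavy d|%:R <= All / 2.
Proof.
have eta01 : 0 <= (300^-1 : R) <= 1 by rewrite invr_ge0 ler0n invf_le1 ?ltr0n ?ler1n.
have bound (d : W) : d != 0 -> #|heavy d|%:R <= All * expR (- (#|Y|%:R * (300^-1 ^+ 2 / 8))).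
  move=> d0; apply: card_heavy => //; last exact: sum_outside_gap_ap.
  exact: outside_gap_ap01.
apply: le_trans (ler_sum _ bound) _.
apply: le_trans (_ : \sum_(d : W) All * expR (- (#|Y|%:R * (300^-1 ^+ 2 / 8))) <= _).
  rewrite [leLHS]big_mkcond /=; apply: ler_sum => d _.
  by case: ifP => // _; rewrite mulr_ge0 ?expR_ge0 ?ler0n.
rewrite sumr_const card_mx card_Fp // mul1n -[leLHS]mulr_natr -[leLHS]mulrA ler_wpM2l ?ler0n //.
set q : R := (p * m)%:R.
have q1 : 1 <= q by rewrite ler1n muln_gt0 prime_gt0 //=; lia.
apply: le_trans (_ : expR (- (2 * q)) * expR q <= _).
  apply: ler_pM; rewrite ?expR_ge0 ?ler0n //.
    by rewrite ler_expR lerN2; move: Y_large; rewrite -/q; lra.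
  rewrite natrX /q natrM mulrC expRM_natl lerXn2r ?nnegrE ?ler0n ?expR_ge0 //.
  by apply: le_trans (expR_ge1Dx _); rewrite lerDr.
rewrite -expRD (_ : _ + q = - q); last by ring.
rewrite expRN lef_pV2 ?posrE ?expR_gt0 ?ltr0n //.
by apply: le_trans (expR_ge1Dx _); lra.
Qed.

(** The union bound over both kinds of failure: at most 1/2 for sum_heavy and at most 1/4
    for sum_dependent. *)
Lemma directions_exist : exists v : V -> W,
  (forall x d, d != 0 -> independent3 (v x) (v (x + d)) (v (x + d *+ 2))) /\
  (forall d, d != 0 -> \sum_(x in Y) outside_gap_ap R (dot (v x) d)
      <= (base_density p R ^+ 3 - 300^-1) * #|Y|%:R).
Proof.
case: (pickP (fun v : {ffun V -> W} =>
    [forall d : W, (d != 0) ==> (v \notin heavy d)] &&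
    [forall i, nontrivial_relation i ==> (v \notin dependent i)])) => [v|none].
  case/andP => /forall_inP light /forall_inP indep; exists v; split.
    move=> x d d0 a0 a1 a2 rel.
    have [[-> -> ->]//|a_neq0] := eqVneq (a0, a1, a2) (0, 0, 0).
    have := indep (x, d, (a0, a1, a2)); rewrite /nontrivial_relation /= d0 => /(_ a_neq0).
    by rewrite inE rel eqxx.
  move=> d /light; rewrite inE -leNgt => /le_trans; apply.
  by rewrite ler_wpM2r ?ler0n //; lra.
exfalso; have : All <= \sum_(d : W | d != 0) #|heavy d|%:R
    + \sum_(i | nontrivial_relation i) #|dependent i|%:R.
  have cardE (S : {set {ffun V -> W}}) : #|S|%:R = \sum_v (v \in S)%:R :> R.
    by rewrite -sum1_card natr_sum big_mkcond; apply: eq_bigr => v _; case: ifP.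
  under eq_bigr do rewrite cardE.
  under [X in _ + X]eq_bigr do rewrite cardE.
  rewrite exchange_big [X in _ + X]exchange_big -big_split /All -sumr_const /=.
  apply: ler_sum => v _; have /negbT := none v.
  rewrite negb_and !negb_forall => /orP[/existsP[d]|/existsP[i]].
    rewrite negb_imply negbK => /andP[d0 dv].
    apply: le_trans (indicator_sum_ge1 R (P := fun e => e != 0)
      (b := fun e => v \in heavy e) d0 dv) _.
    by rewrite /= lerDl; apply: sumr_ge0 => ? _; exact: ler0n.
  rewrite negb_imply negbK => /andP[i0 iv].
  apply: le_trans (indicator_sum_ge1 R (P := nontrivial_relation)
    (b := fun j => v \in dependent j) i0 iv) _.
  by rewrite /= lerDr; apply: sumr_ge0 => ? _; exact: ler0n.
have := sum_heavy; have := sum_dependent; have := All_gt0; lra.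
Qed.
End Directions.

(** * Stages of the construction *)

Section RowSplit.
Variables (T : finNzRingType) (n m : nat).

Lemma sum_row_mx (K : nmodType) (G : 'rV[T]_n -> 'rV[T]_m -> K) :
  \sum_(z : 'rV[T]_(n + m)) G (lsubmx z) (rsubmx z) = \sum_x \sum_y G x y.
Proof.
rewrite pair_big /= (reindex (fun q : 'rV[T]_n * 'rV[T]_m => row_mx q.1 q.2)) /=.
  by apply: eq_bigr => q _; rewrite row_mxKl row_mxKr.
exists (fun z : 'rV[T]_(n + m) => (lsubmx z, rsubmx z)) => z _ /=.
  by rewrite row_mxKl row_mxKr; case: z.
by rewrite hsubmxK.
Qed.
End RowSplit.

Lemma subset_of_card (T : finType) (U : {set T}) k :
  (k <= #|U|)%N -> exists2 Y : {set T}, Y \subset U & #|Y| = k.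
Proof.
move=> kU; exists [set x in take k (enum U)].
  by apply/subsetP => x; rewrite inE => /mem_take; rewrite mem_enum.
rewrite cardsE (card_uniqP _) ?take_uniq ?enum_uniq // size_take -cardE.
by case: ltngtP kU.
Qed.

Section Stage.
Variables (p : nat) (p_pr : prime p) (p_odd : odd p) (R : realType) (n1 : nat) (eps : R).
Hypothesis eps_small : 2 * eps * (p ^ n1)%:R ^+ 2 <= 1.
Hypothesis n1_gt0 : (0 < n1)%N.

Local Notation alpha := (base_density p R).
Local Notation outside_gap := (@outside_gap p R).
Definition mean_weight : R := alpha * (1 - (p ^ n1)%:R^-1).

Local Notation beta := mean_weight.

(** On U the value is still undecided and equal to its mean alpha; off U the function is
    the indicator of P. *)
Definition weight n (U P : {set 'rV['F_p]_n}) x : R :=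
  if x \in U then alpha else (x \in P)%:R.

(** The number u of decided points is the only measure of progress: the mean of the cube
    of the weight exceeds the cube of the mean by at most a constant times its
    density.  The last condition says that this density never falls below its
    initial value p ^ - n1. *)
Definition stage n u := exists U P : {set 'rV['F_p]_n},
  [/\ #|~: U| = u,
      \sum_x weight U P x = beta * (p ^ n)%:R,
      forall d, d != 0 ->
        \sum_x weight U P x * weight U P (x + d) * weight U P (x + d *+ 2)
          < (beta ^+ 3 - eps) * (p ^ n)%:R
    & (p ^ n <= p ^ n1 * u)%N].

Let pN_gt0 n : 0 < (p ^ n)%:R :> R.
Proof. by rewrite ltr0n expn_gt0 prime_gt0. Qed.

Let a_bounds : 2 / 3 <= alpha <= 4 / 5.
Proof. exact: base_density_bounds. Qed.

Lemma double_neq0 n (d : 'rV['F_p]_n) : d != 0 -> d *+ 2 != 0.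
Proof. by move=> d0; rewrite -scaler_nat scaler_eq0 negb_or two_neq0. Qed.

(** With one zero among p ^ n1 points, three points are lost for each difference, whereas
    the cube of the mean loses slightly less than 3 p ^ - n1; the gap is of order
    p ^ (- 2 n1), which is where eps comes in. *)
Lemma stage_init : stage n1 1.
Proof.
have cV : #|{: 'rV['F_p]_n1}| = (p ^ n1)%N := card_rV p_pr n1.
exists [set~ 0], set0; split.
- by rewrite setCK cards1.
- rewrite /weight big_mkcond (bigD1 0) //= !inE eqxx add0r.
  rewrite (eq_bigr (fun=> alpha)) => [|x x0]; last by rewrite !inE x0.
  rewrite sumr_const cardC1 cV /mean_weight -[LHS]mulr_natr -subn1 natrB ?expn_gt0 ?prime_gt0 //.
  by field; rewrite gt_eqF.
- move=> d d0; have d20 := double_neq0 d0.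
  pose S : {set 'rV['F_p]_n1} := 0 |: (- d |: [set - (d *+ 2)]).
  have cS : #|S| = 3%N.
    have h1 : 0 != - d by rewrite eq_sym oppr_eq0.
    have h2 : 0 != - (d *+ 2) by rewrite eq_sym oppr_eq0.
    have h3 : - d != - (d *+ 2).
      by rewrite eqr_opp mulr2n -subr_eq0 opprD addrA subrr sub0r oppr_eq0.
    by rewrite /S !cardsU1 cards1 !inE (negPf h1) (negPf h2) (negPf h3).
  have le_sum : \sum_x weight [set~ 0] set0 x * weight [set~ 0] set0 (x + d)
      * weight [set~ 0] set0 (x + d *+ 2) <= alpha ^+ 3 * ((p ^ n1)%:R - 3).
    have -> : alpha ^+ 3 * ((p ^ n1)%:R - 3) = \sum_(x in ~: S) alpha ^+ 3.
      rewrite sumr_const cardsCs setCK cV cS -[RHS]mulr_natr natrB //.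
      by rewrite -cS -cV max_card.
    rewrite [leRHS]big_mkcond; apply: ler_sum => x _; rewrite !inE /weight !inE.
    rewrite (addr_eq0 x d) (addr_eq0 x (d *+ 2)).
    case: eqP => _; rewrite ?mul0r //=; case: eqP => _; rewrite ?mulr0 ?mul0r //=.
    by case: eqP => _; rewrite ?mulr0 //= -expr2 -exprSr.
  apply: le_lt_trans le_sum _; rewrite /mean_weight exprMn.
  have N3 : (3 : R) <= (p ^ n1)%:R.
    by rewrite ler_nat -cS -cV max_card.
  have N_gt0 := pN_gt0 n1; move: a_bounds eps_small.
  move: ((p ^ n1)%:R : R) N3 N_gt0 => N N3 N_gt0 /andP[a_lo a_hi] eps_le.
  have a3 : (2 / 3) ^+ 3 <= alpha ^+ 3 by rewrite lerXn2r ?nnegrE //; lra.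
  rewrite -(ltr_pM2r N_gt0) -subr_gt0.
  have -> : (alpha ^+ 3 * (1 - N^-1) ^+ 3 - eps) * N * N - alpha ^+ 3 * (N - 3) * N
     = alpha ^+ 3 * (3 - N^-1) - eps * N ^+ 2.
    by field; rewrite gt_eqF.
  have NV : N^-1 <= 1 by rewrite invf_le1 //; lra.
  have : alpha ^+ 3 * 2 <= alpha ^+ 3 * (3 - N^-1).
    by rewrite ler_wpM2l ?exprn_ge0 //; lra.
  by lra.
by rewrite muln1.
Qed.
End Stage.

(** * Refining a stage *)

Section Step.
Variables (p : nat) (p_pr : prime p) (p_odd : odd p) (R : realType) (n1 : nat) (eps : R).
Hypothesis eps_small : 2 * eps * (p ^ n1)%:R ^+ 2 <= 1.
Local Notation alpha := (base_density p R).
Local Notation outside_gap := (@outside_gap p R).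
Local Notation beta := (mean_weight p R n1).
Local Notation stage := (@stage p R n1 eps).

Let pN_gt0 n : 0 < (p ^ n)%:R :> R.
Proof. by rewrite ltr0n expn_gt0 prime_gt0. Qed.

Let a_bounds : 2 / 3 <= alpha <= 4 / 5.
Proof. exact: base_density_bounds. Qed.

Section Refine.
Variables (n m : nat) (U P Y : {set 'rV['F_p]_n}) (v : 'rV['F_p]_n -> 'rV['F_p]_m).
Hypothesis YU : Y \subset U.
Local Notation f := (weight R U P).

Definition refine_U : {set 'rV['F_p]_(n + m)} := [set z | lsubmx z \in U :\: Y].
Definition refine_P : {set 'rV['F_p]_(n + m)} :=
  [set z | if lsubmx z \in Y then (gap p <= dot (rsubmx z) (v (lsubmx z)))%N
           else lsubmx z \in P].

(** The value above x as a function of the scalar product with the direction of x. *)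
Definition refine_val x (t : 'F_p) : R := if x \in Y then outside_gap t else f x.

Lemma weight_refine z :
  weight R refine_U refine_P z = refine_val (lsubmx z) (dot (rsubmx z) (v (lsubmx z))).
Proof.
rewrite /refine_val /weight !inE; case: ifP => [/andP[/negPf-> ->]//|].
by case: ifP => //= _ ->.
Qed.

Lemma sum_refine_val x c : \sum_t refine_val x (t + c) = p%:R * f x.
Proof.
rewrite /refine_val; case: (boolP (x \in Y)) => [Yx|_].
  by rewrite /weight (subsetP YU _ Yx) -sum_outside_gap // [RHS](reindex_inj (addIr c)).
by rewrite sumr_const card_Fp // mulr_natl.
Qed.

Lemma card_refine_U : #|~: refine_U| = ((#|~: U| + #|Y|) * p ^ m)%N.
Proof.
have -> : ~: refine_U = [set z | lsubmx z \in ~: (U :\: Y)].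
  by apply/setP => z; rewrite !inE.
rewrite -sum1_card (eq_bigl (fun z => lsubmx z \in ~: (U :\: Y))); last first.
  by move=> z; rewrite inE.
rewrite big_mkcond /= (sum_row_mx (fun x (_ : 'rV_m) => if x \in ~: (U :\: Y) then 1 else 0)%N).
transitivity (\sum_(x in ~: (U :\: Y)) p ^ m)%N.
  rewrite [RHS]big_mkcond; apply: eq_bigr => x _.
  by case: ifP => _; rewrite sum_nat_const card_mx card_Fp // mul1n ?muln1 ?muln0.
rewrite sum_nat_const; congr (_ * _)%N.
rewrite setDE setCI setCK cardsU setIC -setDE.
by move: YU; rewrite -setD_eq0 => /eqP->; rewrite cards0 subn0.
Qed.

Hypothesis v_indep :
  forall x d, d != 0 -> independent3 (v x) (v (x + d)) (v (x + d *+ 2)).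
Hypothesis n_gt0 : (0 < n)%N.

Lemma direction_neq0 x : v x != 0.
Proof.
have [d d0] : exists d : 'rV['F_p]_n, d != 0.
  exists (const_mx 1); apply/eqP => /rowP/(_ (Ordinal n_gt0)).
  by rewrite !mxE => /eqP; rewrite oner_eq0.
apply/eqP => vx; have [] := @v_indep x d d0 1 0 0.
  by rewrite vx scaler0 !scale0r !addr0.
by move/eqP; rewrite oner_eq0.
Qed.

Lemma sum_refine_fiber x G (S : R) : \sum_(t : 'F_p) G t = p%:R * S ->
  \sum_y G (dot y (v x)) = (p ^ m)%:R * S.
Proof.
have p_neq0 : p%:R != 0 :> R by rewrite pnatr_eq0 -lt0n prime_gt0.
move=> GS; apply: (mulIf p_neq0).
by rewrite (equidistribution1 p_pr G (direction_neq0 x)) GS; ring.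
Qed.

Lemma sum_weight_refine :
  \sum_z weight R refine_U refine_P z = (p ^ m)%:R * \sum_x f x.
Proof.
under eq_bigr do rewrite weight_refine.
rewrite (sum_row_mx (fun x y => refine_val x (dot y (v x)))) mulr_sumr.
apply: eq_bigr => x _; apply: sum_refine_fiber.
by rewrite -(sum_refine_val x 0); apply: eq_bigr => t _; rewrite addr0.
Qed.

Lemma ap_refine (d : 'rV['F_p]_(n + m)) (d1 := lsubmx d) (d2 := rsubmx d) :
  \sum_z weight R refine_U refine_P z * weight R refine_U refine_P (z + d)
     * weight R refine_U refine_P (z + d *+ 2)
  = \sum_x \sum_y refine_val x (dot y (v x))
     * refine_val (x + d1) (dot y (v (x + d1)) + dot d2 (v (x + d1)))
     * refine_val (x + d1 *+ 2)
        (dot y (v (x + d1 *+ 2)) + dot (d2 *+ 2) (v (x + d1 *+ 2))).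
Proof.
rewrite -(sum_row_mx (fun x y => refine_val x (dot y (v x))
     * refine_val (x + d1) (dot y (v (x + d1)) + dot d2 (v (x + d1)))
     * refine_val (x + d1 *+ 2)
        (dot y (v (x + d1 *+ 2)) + dot (d2 *+ 2) (v (x + d1 *+ 2))))).
apply: eq_bigr => z _; rewrite !weight_refine -!dotDl.
by rewrite !linearD.
Qed.

(** When x moves, the three directions are independent and the fibre average of the
    product is the product of the fibre averages. *)
Lemma ap_refine_old (d : 'rV['F_p]_(n + m)) (d1 := lsubmx d) : d1 != 0 ->
  \sum_z weight R refine_U refine_P z * weight R refine_U refine_P (z + d)
     * weight R refine_U refine_P (z + d *+ 2)
  = (p ^ m)%:R * \sum_x f x * f (x + d1) * f (x + d1 *+ 2).
Proof.
move=> d10; rewrite ap_refine mulr_sumr; apply: eq_bigr => x _.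
have p3_neq0 : p%:R ^+ 3 != 0 :> R by rewrite expf_neq0 // pnatr_eq0 -lt0n prime_gt0.
apply: (mulIf p3_neq0).
have := equidistribution3 p_pr (refine_val x)
  (fun t => refine_val (x + d1) (t + dot (rsubmx d) (v (x + d1))))
  (fun t => refine_val (x + d1 *+ 2) (t + dot (rsubmx d *+ 2) (v (x + d1 *+ 2))))
  (@v_indep x d1 d10).
rewrite /= => ->; rewrite !sum_refine_val.
have -> : \sum_t refine_val x t = p%:R * f x.
  by rewrite -(sum_refine_val x 0); apply: eq_bigr => t _; rewrite addr0.
by ring.
Qed.

(** The product of y with v x is uniform on F_p, so that in a fibre above Y the sum
    over y becomes the sum in outside_gap_ap. *)
Lemma ap_refine_new (d : 'rV['F_p]_(n + m)) : lsubmx d = 0 ->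
  \sum_z weight R refine_U refine_P z * weight R refine_U refine_P (z + d)
     * weight R refine_U refine_P (z + d *+ 2)
  = (p ^ m)%:R * (\sum_(x in ~: Y) f x ^+ 3
      + \sum_(x in Y) outside_gap_ap R (dot (v x) (rsubmx d))).
Proof.
move=> d10; rewrite ap_refine d10 mul0rn.
rewrite [X in _ * (X + _)]big_mkcond [X in _ * (_ + X)]big_mkcond -big_split.
rewrite mulr_sumr; apply: eq_bigr => x _; rewrite !addr0 inE /refine_val.
have p_neq0 : p%:R != 0 :> R by rewrite pnatr_eq0 -lt0n prime_gt0.
case: (x \in Y) => /=.
  rewrite add0r; set e := dot (v x) _.
  rewrite -(@sum_refine_fiber x (fun t =>
    outside_gap t * outside_gap (t + e) * outside_gap (t + e *+ 2))).
    apply: eq_bigr => y _; rewrite /e (dotC (v x)).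
    by rewrite -[rsubmx d *+ 2]scaler_nat dotZl (mulr_natl (dot _ _)).
  by rewrite /outside_gap_ap [RHS]mulrC divfK.
rewrite addr0 sumr_const card_mx card_Fp // mul1n -[LHS]mulr_natl; congr (_ * _); ring.
Qed.
End Refine.

(** The weight and its cube differ only on U. *)
Lemma sum_weight_cube n (U P : {set 'rV['F_p]_n}) :
    \sum_x weight R U P x = beta * (p ^ n)%:R ->
  \sum_x weight R U P x ^+ 3
  = beta * (p ^ n)%:R - (alpha - alpha ^+ 3) * ((p ^ n)%:R - #|~: U|%:R).
Proof.
move=> <-.
have -> : (alpha - alpha ^+ 3) * ((p ^ n)%:R - #|~: U|%:R)
   = \sum_(x in U) (alpha - alpha ^+ 3).
  rewrite sumr_const -[RHS]mulr_natr; congr (_ * _).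
  rewrite -(card_rV p_pr n).
  by rewrite -(cardsC U) natrD addrK.
rewrite [X in _ - X]big_mkcond -sumrB; apply: eq_bigr => x _.
by rewrite /weight; case: ifP => _; [ring|]; case: (_ \in P); rewrite subr0 ?expr1n ?expr0n.
Qed.

(** Each fibre above Y saves 1/300 against alpha ^ 3.  Summed over the space, the cube of
    the weight exceeds the cube of the mean minus eps by less than 4u, because the
    weight differs from alpha at u points only and eps is small compared with the
    density of these points; hence 1200 u points in Y suffice. *)
Lemma stage_step n m u k : (0 < n)%N -> stage n u -> (2 * n + 5 <= m)%N ->
    2 ^+ 21 * (p * m)%:R <= k%:R :> R -> (1200 * u <= k)%N -> (k + u <= p ^ n)%N ->
  stage (n + m) ((u + k) * p ^ m).
Proof.
move=> n_gt0 [U [P [cardU sumU apU u_large]]] m_large k_large ku kU.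
have [|Y YU cardY] := @subset_of_card _ U k.
  have : #|{: 'rV['F_p]_n}| = (p ^ n)%N := card_rV p_pr n.
  by rewrite -(cardsC U) cardU; lia.
have Y_large : 2 ^+ 21 * (p * m)%:R <= #|Y|%:R :> R by rewrite cardY.
have [v [v_indep v_light]] := directions_exist p_pr p_odd m_large Y_large.
exists (refine_U m U Y), (refine_P P Y v); split.
- by rewrite card_refine_U // cardU cardY.
- by rewrite sum_weight_refine // sumU expnD natrM; ring.
- move=> d d0; rewrite expnD natrM.
  have [d10|d10] := eqVneq (lsubmx d) 0; last first.
    rewrite ap_refine_old // mulrC mulrA ltr_pM2r //; exact: apU.
  rewrite ap_refine_new //.
  have d20 : rsubmx d != 0.
    by apply: contraNneq d0 => d20; rewrite -[d]hsubmxK d10 d20 row_mx0.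
  rewrite mulrC mulrA ltr_pM2r //.
  have := v_light _ d20; rewrite cardY.
  have : \sum_(x in ~: Y) weight R U P x ^+ 3 + \sum_(x in Y) alpha ^+ 3
      = \sum_x weight R U P x ^+ 3.
    rewrite big_mkcond [X in _ + X]big_mkcond -big_split; apply: eq_bigr => x _ /=.
    rewrite inE; case: (boolP (x \in Y)) => [Yx|_] /=; last by rewrite addr0.
    by rewrite add0r /weight (subsetP YU _ Yx).
  rewrite sumr_const cardY -(mulr_natl (alpha ^+ 3)) sum_weight_cube // cardU.
  have N1_gt0 := pN_gt0 n1; have N_gt0 := pN_gt0 n.
  have u_ge : (p ^ n)%:R / (p ^ n1)%:R <= u%:R :> R.
    by rewrite ler_pdivrMr // -natrM ler_nat mulnC.
  have k_ge : 1200 * u%:R <= k%:R :> R by rewrite -natrM ler_nat.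
  have eps_le : eps * (p ^ n)%:R <= (p ^ n)%:R / (p ^ n1)%:R / 2.
    rewrite mulrC -mulrA ler_pM2l // ler_pdivlMr // mulrC.
    rewrite -(ler_pM2r N1_gt0) -(ler_pM2r N1_gt0) mulVf ?gt_eqF // mul1r.
    rewrite -mulrA -expr2; apply: le_trans eps_small _.
    by rewrite ler1n expn_gt0 prime_gt0.
  have w_gt0 : 0 < (p ^ n)%:R / (p ^ n1)%:R :> R by rewrite divr_gt0.
  have beta_ge : alpha ^+ 3 * ((p ^ n)%:R - 3 * ((p ^ n)%:R / (p ^ n1)%:R))
      <= beta ^+ 3 * (p ^ n)%:R.
    have x01 : 0 <= ((p ^ n1)%:R^-1 : R) <= 1.
      by rewrite invr_ge0 ler0n invf_le1 // ler1n expn_gt0 prime_gt0.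
    rewrite /mean_weight exprMn -[leRHS]mulrA ler_wpM2l ?exprn_ge0 //.
      by case/andP: a_bounds; lra.
    move: x01; set x := _^-1 => /andP[x0 x1].
    rewrite -subr_ge0 (_ : _ - _ = (p ^ n)%:R * (x ^+ 2 * (3 - x))); last by ring.
    by rewrite mulr_ge0 ?ler0n // mulr_ge0 ?sqr_ge0 //; lra.
  have betaE : beta * (p ^ n)%:R = alpha * (p ^ n)%:R
      - alpha * ((p ^ n)%:R / (p ^ n1)%:R) by rewrite /mean_weight; ring.
  rewrite betaE; case/andP: a_bounds => a_lo a_hi.
  have a3 : alpha ^+ 3 <= alpha.
    by rewrite exprS -[leRHS]mulr1 ler_wpM2l ?exprn_ile1 //; lra.
  have a3_ge0 : 0 <= alpha ^+ 3 by rewrite exprn_ge0 //; lra.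
  move: (\sum_(x in ~: Y) _) (\sum_(x in Y) _) ((p ^ n)%:R / (p ^ n1)%:R : R)
    u_ge eps_le w_gt0 beta_ge => S1 S2 w u_ge eps_le w_gt0 beta_ge eqS leS2.
  have u_gt0 : 0 < u%:R :> R by apply: lt_le_trans u_ge.
  have b1 : (alpha - alpha ^+ 3) * u%:R <= u%:R by nra.
  have b2 : 3 * (alpha ^+ 3 * w) - alpha * w <= 2 * u%:R by nra.
  lra.
by rewrite expnD mulnA leq_mul2r; apply/orP; right; nia.
Qed.
End Step.

(** * Iterating the construction *)

Lemma linear_le_expn p n : (2 < p)%N -> (8 <= n)%N -> (2 * n + 5 <= p ^ n./2)%N.
Proof.
move=> p3 n8; have lo : (4 * n./2 + 7 <= 3 ^ n./2)%N.
  have : (4 <= n./2)%N by lia.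
  elim: n./2 => // k IHk; rewrite leq_eqVlt => /orP[/eqP <-//|k4].
  by rewrite expnS; have := IHk k4; lia.
apply: leq_trans (_ : 3 ^ n./2 <= _)%N; first by lia.
by case: n./2 => // k; rewrite leq_exp2r.
Qed.

Section Tower.
Variables (p : nat) (p_pr : prime p) (p_odd : odd p) (R : realType) (n1 : nat) (eps : R).
Hypothesis eps_small : 2 * eps * (p ^ n1)%:R ^+ 2 <= 1.
Local Notation stage := (@stage p R n1 eps).

(** Once no point is undecided, the weight is the indicator of a set. *)
Lemma stage_complete n : stage n (p ^ n) -> ~ has_popular_difference p eps n.
Proof.
case=> U [P [cardU sumU apU _]] /(_ P)[d d0].
have cV : #|{: 'rV['F_p]_n}| = (p ^ n)%N := card_rV p_pr n.
have U0 : U = set0.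
  by apply: cards0_eq; have := cardsC U; rewrite cardU cV; lia.
have N_gt0 : 0 < (p ^ n)%:R :> R by rewrite ltr0n expn_gt0 prime_gt0.
have wE x : weight R U P x = (x \in P)%:R by rewrite /weight U0 inE.
have -> : density R P = mean_weight p R n1.
  apply: (mulIf (lt0r_neq0 N_gt0)); rewrite -sumU /density divfK ?gt_eqF //.
  rewrite -sum1_card natr_sum big_mkcond; apply: eq_bigr => x _.
  by rewrite wE; case: ifP.
rewrite /ap3_density ler_pdivlMr // leNgt => /negP; apply.
apply: le_lt_trans (apU d d0); rewrite le_eqVlt; apply/orP; left; apply/eqP.
rewrite -sum1_card natr_sum big_mkcond; apply: eq_bigr => x _.
by rewrite inE !wE; do 3!case: (_ \in P); rewrite ?mulr1 ?mulr0 ?mul0r.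
Qed.

Variables (C0 s : nat).
Hypothesis C0E : C0%:R = 2 ^+ 21 :> R.
Hypothesis C0_ge : (1200 <= C0)%N.
Hypothesis C0_sqr : (C0 ^ 2 <= p ^ n1)%N.
Hypothesis n1_ge : (4 <= n1)%N.
Local Notation k0 := (C0 * (p * (2 * n1 + 5)))%N.
Hypothesis room : (2400 * 1201 ^ s * (1 + k0) <= p ^ n1)%N.

Lemma stage_step_nat n m u k : (0 < n)%N -> stage n u -> (2 * n + 5 <= m)%N ->
    (C0 * (p * m) <= k)%N -> (1200 * u <= k)%N -> (k + u <= p ^ n)%N ->
  stage (n + m) ((u + k) * p ^ m).
Proof.
move=> n_gt0 stn m_ge k_ge ku kN; apply: stage_step => //.
by rewrite -C0E -natrM ler_nat.
Qed.

(** A stage at which the choice dim W = p ^ (n / 2) and #|Y| = 1200 u meets the requirement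
    of the Chernoff bound. *)
Definition roomy_stage n u := [/\ stage n u, (3 * n1 + 5 <= n)%N, (p ^ n <= p ^ n1 * u)%N
  & (C0 * (p * p ^ n./2) <= 1200 * u)%N].

Lemma roomy_stageI n u : stage n u -> (3 * n1 + 5 <= n)%N -> roomy_stage n u.
Proof.
move=> stn n_ge; have [U [P [_ _ _ u_ge]]] := stn; split=> //.
have p1 := prime_gt1 p_pr.
have : (p ^ (n - n1) <= u)%N.
  rewrite -(@leq_pmul2l (p ^ n1)) ?expn_gt0 ?prime_gt0 // -expnD subnKC //; lia.
suff : (C0 * p ^ (1 + n./2) <= p ^ (n - n1))%N by rewrite expnD expn1; lia.
rewrite -leq_sqr expnMn -!expnM.
apply: leq_trans (_ : p ^ n1 * p ^ ((1 + n./2) * 2) <= _)%N.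
  by rewrite leq_mul2r C0_sqr orbT.
by rewrite -expnD leq_exp2l //; lia.
Qed.

(** The first refinement is special: there is only one decided point, so Y must be chosen
    larger than 1200 u in order to carry a space W of dimension linear in n1.
    From then on #|Y| = 1200 u, the density of decided points grows by a factor of
    1201, and the dimension grows from n to more than p ^ (n / 2). *)
Lemma stage_tower j : (j <= s)%N -> exists n u,
  [/\ roomy_stage n u, (2 * tower p j + 2 <= n)%N & (u * p ^ n1 <= 1201 ^ j * (1 + k0) * p ^ n)%N].
Proof.
have p1 := prime_gt1 p_pr; have p3 := odd_prime_gt2 p_odd p_pr.
have room' := room; move: room'; set K := (1 + k0)%N => room'.
have q_gt0 : (0 < p ^ n1)%N by rewrite expn_gt0 ltnW.
elim: j => [|j IHj] js.
  (* Y has k0 points, enough for dim W = 2 n1 + 5 *)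
  exists (n1 + (2 * n1 + 5))%N, (K * p ^ (2 * n1 + 5))%N; split.
  - apply: roomy_stageI; last by lia.
    apply: stage_step_nat => //; first by lia.
    + by apply: stage_init => //; lia.
    + rewrite muln1; apply: leq_trans C0_ge _; rewrite leq_pmulr // muln_gt0; lia.
    + rewrite addnC; apply: leq_trans room'; rewrite leq_pmull //.
      by rewrite muln_gt0 expn_gt0.
  - by rewrite /=; lia.
  by rewrite mul1n -mulnA -expnD (addnC n1).
have [n [u [[stn n_ge uN k_ge] n_tower u_le]]] := IHj (ltnW js).
exists (n + p ^ n./2)%N, ((u + 1200 * u) * p ^ (p ^ n./2))%N; split.
- apply: roomy_stageI; last by lia.
  apply: stage_step_nat => //; first by lia.
    by apply: linear_le_expn => //; lia.
  rewrite -(@leq_pmul2r (p ^ n1)) //; apply: leq_trans (_ : 1201 * (u * p ^ n1) <= _)%N.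
    by nia.
  apply: leq_trans (_ : 1201 * (1201 ^ j * K * p ^ n) <= _)%N.
    by rewrite leq_mul2l u_le orbT.
  rewrite [X in (_ <= X)%N]mulnC !mulnA leq_mul2r; apply/orP; right.
  apply: leq_trans room'; rewrite leq_mul2r; apply/orP; right.
  rewrite -expnS; apply: leq_trans (_ : 1201 ^ s <= _)%N.
    by rewrite leq_exp2l.
  by rewrite leq_pmull.
- rewrite /=; have : (p * p ^ tower p j <= p ^ n./2)%N.
    by rewrite -expnS leq_exp2l //; lia.
  by nia.
rewrite -mulSn -mulnA [(p ^ (p ^ _) * _)%N]mulnC [X in (X <= _)%N]mulnA expnD mulnA.
rewrite leq_mul2r; apply/orP; right.
by rewrite expnS -!mulnA leq_mul2l /= mulnA.
Qed.

(** The room left by the hypothesis lets the last refinement decide all remaining points. *)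
Lemma unpopular_above_tower : exists2 n, (tower p s <= n)%N & ~ has_popular_difference p eps n.
Proof.
have p1 := prime_gt1 p_pr; have p3 := odd_prime_gt2 p_odd p_pr.
have room' := room; move: room' (stage_tower (leqnn s)); set K := (1 + k0)%N => room'.
case=> n [u [[stn n_ge uN k_ge] n_tower u_le]].
have q_gt0 : (0 < p ^ n1)%N by rewrite expn_gt0 ltnW.
exists (n + p ^ n./2)%N; first by lia.
have u2400 : (2400 * u <= p ^ n)%N.
  rewrite -(@leq_pmul2r (p ^ n1)) // -mulnA.
  apply: leq_trans (_ : 2400 * (1201 ^ s * K * p ^ n) <= _)%N.
    by rewrite leq_mul2l u_le orbT.
  rewrite [X in (_ <= X)%N]mulnC !mulnA leq_mul2r; apply/orP; right.
  exact: room'.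
apply: stage_complete; rewrite [in X in stage _ X]expnD.
rewrite -[X in stage _ (X * _)](@subnKC u); last by lia.
apply: stage_step_nat => //; try lia.
by apply: linear_le_expn => //; lia.
Qed.
End Tower.

(** * Numerical bounds and the theorem *)

Section Log2.
Variable R : realType.

Lemma exp2_le_log2 (x : R) n : 0 < x -> (2 ^+ n <= x) = (n%:R <= log2 x).
Proof.
move=> x0; have ln2 : 0 < ln 2 :> R by rewrite ln_gt0 // ltr1n.
rewrite /log2 ler_pdivlMr // mulr_natl -lnXn ?ltr0n //.
by rewrite ler_ln // posrE ?exprn_gt0 ?ltr0n.
Qed.
End Log2.

(** Here p is at most the fourth root of p ^ n1, and 2 n1 + 5 at most three times its square
    root, so the claim is checked after raising to the fourth power. *)
Lemma enough_room p n1 s C0 : (2 < p)%N -> (4 <= n1)%N -> (0 < s)%N ->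
    (2 ^ (187 * s) <= p ^ n1)%N -> C0 = (2 ^ 21)%N ->
  (2400 * 1201 ^ s * (1 + C0 * (p * (2 * n1 + 5))) <= p ^ n1)%N.
Proof.
move=> p3 n1_ge s_gt0 q187 C0E; set w := (2 * n1 + 5)%N.
have p1 := ltnW p3.
have w2 : (w ^ 2 <= 9 * 3 ^ n1)%N.
  rewrite /w; elim: {+}n1 n1_ge => // k IHk; rewrite leq_eqVlt => /orP[/eqP <-//|k4].
  apply: leq_trans (_ : 3 * (2 * k + 5) ^ 2 <= _)%N; first by rewrite -!mulnn; nia.
  by rewrite (expnS 3) (mulnCA 9%N) leq_mul2l IHk.
have pw4 : ((p * w) ^ 4 <= 81 * (p ^ n1) ^ 3)%N.
  rewrite expnMn (_ : w ^ 4 = (w ^ 2) ^ 2)%N; last by rewrite -expnM.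
  apply: leq_trans (_ : p ^ n1 * (9 * 3 ^ n1) ^ 2 <= _)%N.
    by rewrite leq_mul ?leq_exp2l // leq_sqr.
  apply: leq_trans (_ : p ^ n1 * (9 * p ^ n1) ^ 2 <= _)%N.
    by rewrite leq_mul2l leq_sqr leq_mul2l leq_exp2r ?orbT //; lia.
  by move: (p ^ n1)%N => q; rewrite -!mulnn expnS -mulnn; lia.
have pw_gt0 : (0 < p * w)%N by rewrite muln_gt0 /w; lia.
apply: leq_trans (_ : 2 ^ (45 * s) * (p * w) <= _)%N.
  apply: leq_trans (_ : 2 ^ 12 * 2 ^ (11 * s) * (2 ^ 22 * (p * w)) <= _)%N.
    apply: leq_mul; first apply: leq_mul => //.
      by rewrite expnM leq_exp2r.
    rewrite expnS -C0E -mulnA mul2n -addnn leq_add2r muln_gt0 C0E expn_gt0 //.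
  by rewrite mulnA leq_mul2r -!expnD leq_exp2l //; apply/orP; right; lia.
rewrite -(@leq_exp2r _ _ 4) // expnMn -expnM.
apply: leq_trans (_ : 2 ^ (45 * s * 4) * (81 * (p ^ n1) ^ 3) <= _)%N.
  by rewrite leq_mul2l pw4 orbT.
rewrite (expnS _ 3) mulnA leq_mul2r; apply/orP; right.
apply: leq_trans q187; apply: leq_trans (_ : 2 ^ (45 * s * 4) * 2 ^ 7 <= _)%N.
  by rewrite leq_mul2l orbT.
by rewrite -expnD leq_exp2l //; lia.
Qed.

Lemma tower_height_le (R : realType) (a : R) (l h : nat) :
  l%:R <= a + 1 -> 3 * a + 15 <= h%:R -> (l + 2 + (2 * l + 7) <= h)%N.
Proof. by move=> la ah; rewrite -(ler_nat R) !natrD ?natrM; lra. Qed.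

Section Threshold.
Variables (R : realType) (p : nat) (p_pr : prime p) (p_odd : odd p) (eps : R).
Hypothesis eps_gt0 : 0 < eps.
Hypothesis eps_le : eps <= 2 ^- 161 * p%:R ^- 8.

Let p_gt0 : 0 < p%:R :> R. Proof. by rewrite ltr0n prime_gt0. Qed.
Let x : R := 1 / eps.
Let x_gt0 : 0 < x. Proof. exact: divr_gt0. Qed.

Let x_ge : 2 ^+ 161 * p%:R ^+ 8 <= x.
Proof.
rewrite /x ler_pdivlMr // mulrC -ler_pdivlMr ?mulr_gt0 ?exprn_gt0 //.
by rewrite div1r invfM.
Qed.

Lemma log2_ge161 : 161%:R <= log2 x.
Proof.
rewrite -exp2_le_log2 //; apply: le_trans x_ge.
by rewrite ler_peMr ?exprn_ge0 ?ler0n // exprn_ege1 // ler1n prime_gt0.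
Qed.

Lemma popular_from_tower h : 3 * log2 x + 15 <= h%:R -> popular_from p eps (tower p h).
Proof.
move=> h_ge n n_ge A; have L161 := log2_ge161.
(* K rounds 1 / eps up, and 2 ^ l exceeds it *)
pose l := (Num.trunc (log2 x)).+1.
have l_ge : log2 x < l%:R by exact: truncnS_gt.
have l_le : l%:R <= log2 x + 1.
  by rewrite -natr1 lerD2r truncn_le; lra.
have x_lt : x < 2 ^+ l by rewrite ltNge exp2_le_log2 // -ltNge.
pose K := (Num.trunc x).+1.
have K_gt : x < K%:R by exact: truncnS_gt.
have K_le : (K <= 2 ^ l)%N.
  by rewrite /K truncn_lt_nat ?ltW // natrX.
have [|||d d0 dA] := @popular_difference_tower p p_pr p_odd n A K (2 * l + 7) (l + 2) (ltn0Sn _).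
- rewrite expnD mulnC leq_mul // (mulnC 2) expnM; by rewrite leq_sqr.
- have : (0 < 2 ^ l)%N by rewrite expn_gt0.
  by rewrite expnD; move: K_le; move: (2 ^ l)%N (K) => a b; clear; lia.
- apply: leq_trans n_ge; apply: tower_le; first exact: prime_gt1.
  exact: tower_height_le l_le h_ge.
exists d => //.
have P_gt0 : 0 < (p ^ n)%:R :> R by rewrite ltr0n expn_gt0 prime_gt0.
have K_gt0 : 0 < K%:R :> R by rewrite ltr0n.
apply: le_trans (_ : density R A ^+ 3 - K%:R^-1 <= _).
  rewrite lerD2l lerN2 invf_ple ?posrE // ltW //.
  by rewrite -div1r.
rewrite lerBlDr /density /ap3_density -/(ap_set A d).
rewrite -(ler_pM2l (mulr_gt0 K_gt0 (exprn_gt0 3 P_gt0))).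
move: dA; rewrite -(ler_nat R) natrD !natrM.
move: (p ^ n)%:R P_gt0 => P P_gt0 dA; rewrite -subr_ge0.
move: dA; rewrite -subr_ge0; set u := (X in 0 <= X); set w := (X in _ -> 0 <= X).
suff -> : w = u by [].
by rewrite /u /w; field; rewrite !gt_eqF.
Qed.

(** The exponent n1 is the largest for which stage_init applies, so p ^ (2 n1) lies
    between p ^ - 2 / (2 eps) and 1 / (2 eps); the assumption on eps makes n1 at
    least 4, and then the loss of factors p is harmless. *)
Lemma unpopular_below_tower s : (0 < s)%N -> 600 * s%:R <= log2 x ->
  exists2 n, (tower p s <= n)%N & ~ has_popular_difference p eps n.
Proof.
move=> s_gt0 s_le; have p3 := odd_prime_gt2 p_odd p_pr.
have x_ge_s : 2 ^+ (600 * s) <= x by rewrite exp2_le_log2 // natrM.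
have epsx : eps * x = 1 by rewrite /x mulrC divfK ?gt_eqF.
have x4 : 4 <= x.
  by rewrite (_ : 4 = 2 ^+ 2) ?exp2_le_log2 //; [have := log2_ge161; lra | rewrite expr2; ring].
have [|n1' big minimal] := ex_minnP (P := fun n => 1 < 2 * eps * (p ^ n)%:R ^+ 2).
  pose n := (Num.trunc x).+1; exists n.
  have n_gt : x < n%:R by exact: truncnS_gt.
  have pn_ge : n%:R <= (p ^ n)%:R ^+ 2 :> R.
    rewrite -natrX ler_nat (leq_trans (ltnW (ltn_expl n (prime_gt1 p_pr)))) //.
    by rewrite -[X in (X <= _)%N]expn1 leq_pexp2l // expn_gt0 prime_gt0.
  move: epsx n_gt pn_ge x_gt0 eps_gt0; move: (_ ^+ 2) => Q.
  move: n%:R x => N y; nra.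
have eps4 : eps <= 1 / 4 by nra.
case: n1' => [|n1] in big minimal *.
  by move: big; rewrite expn0 expr1n; lra.
have eps_small : 2 * eps * (p ^ n1)%:R ^+ 2 <= 1.
  by rewrite leNgt; apply/negP => /minimal; rewrite ltnn.
have lt_nat (a : nat) : a%:R <= x -> (a < 2 * p ^ (2 * n1 + 2))%N.
  move=> ax; rewrite -(ltr_nat R); apply: le_lt_trans ax _.
  rewrite (_ : 2 * n1 + 2 = n1.+1 * 2)%N; last by clear; lia.
  rewrite expnM natrM [X in _ * X]natrX -(ltr_pM2l eps_gt0) epsx.
  by rewrite mulrA [eps * _]mulrC.
have q_ge : (2 ^ (600 * s) < 2 * p ^ (2 * n1 + 2))%N.
  by apply: lt_nat; rewrite natrX.
have n1_ge : (4 <= n1)%N.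
  have : (2 ^ 161 * p ^ 8 < 2 * p ^ (2 * n1 + 2))%N.
    by apply: lt_nat; rewrite natrM !natrX.
  case: (ltnP 3 n1) => // n1_le; rewrite ltnNge => /negP[].
  apply: leq_mul; first by rewrite -[X in (X <= _)%N]expn1 leq_exp2l.
  by rewrite leq_exp2l ?prime_gt1 //; move: n1_le; clear; lia.
have q187 : (2 ^ (187 * s) <= p ^ n1)%N.
  rewrite -(@leq_exp2r _ _ 3) // -!expnM -(@leq_pmul2l 2) // -expnS.
  apply: leq_trans (_ : 2 ^ (600 * s) <= _)%N.
    by rewrite leq_exp2l //; move: s_gt0; clear; lia.
  apply: leq_trans (ltnW q_ge) _; rewrite leq_mul2l leq_exp2l ?prime_gt1 //=.
  by move: n1_ge; clear; lia.
have [C0 C0E C0ER] : exists2 C0, C0 = (2 ^ 21)%N & C0%:R = 2 ^+ 21 :> R.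
  by exists (2 ^ 21)%N; rewrite ?natrX.
apply: (@unpopular_above_tower p p_pr p_odd R n1 eps eps_small C0 s C0ER) => //.
- by rewrite C0E; apply: leq_trans (_ : 2 ^ 11 <= _)%N; rewrite ?leq_exp2l.
- by rewrite C0E -expnM; apply: leq_trans q187; rewrite leq_exp2l //; move: s_gt0; clear; lia.
- exact: enough_room.
Qed.
End Threshold.

Theorem theorem2 (R : realType) :
  exists c C : R, [/\ 0 < c, c < C &
    forall p : nat, prime p -> odd p ->
    forall eps : R, 0 < eps -> eps <= 2 ^- 161 * p%:R ^- 8 ->
    exists N : nat, is_popular_threshold p eps N /\
      (tower p `|Num.floor (c * log2 (1 / eps))| <= N
         <= tower p `|Num.ceil (C * log2 (1 / eps))|)%N].
Proof.
(* 600 is what enough_room needs; 100 absorbs 3 log + 15, as log >= 161 *)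
exists 600^-1, 100; split; [by rewrite invr_gt0 ltr0n | lra |].
move=> p p_pr p_odd eps eps_gt0 eps_le.
have L161 := log2_ge161 p_pr eps_gt0 eps_le.
set L := log2 _ in L161 *; set h := `|Num.ceil _|%N.
have h_ge : 3 * L + 15 <= h%:R.
  have ceil_h := ceil_ge (100 * L).
  rewrite /h natr_absz ger0_norm; last by rewrite ceil_ge0; lra.
  by apply: le_trans ceil_h; lra.
have from_h := popular_from_tower p_pr p_odd eps_gt0 eps_le h_ge.
pose good N := (0 < N)%N /\ popular_from p eps N.
have [|N /asboolP[N_gt0 fromN] minimal] := ex_minnP (P := fun N => `[< good N >]).
  exists (tower p h); apply/asboolP; split=> //.
  exact: leq_ltn_trans (tower_gt h (prime_gt1 p_pr)).
exists N; split; first by split=> // M M_gt0 fromM; apply: minimal; apply/asboolP.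
apply/andP; split; last first.
  by apply: minimal; apply/asboolP; split=> //; exact: leq_ltn_trans (tower_gt h (prime_gt1 p_pr)).
set s := `|_|%N; have [->//|s_gt0] := posnP s.
have s_le : 600 * s%:R <= L.
  have := floor_le (600^-1 * L).
  rewrite -(ger0_norm (_ : 0 <= Num.floor (600^-1 * L))); last first.
    by rewrite floor_ge0; lra.
  rewrite -[(_)%:~R]/(`|_|%:~R) -natr_absz -/s; lra.
have [n n_ge unpopular] := unpopular_below_tower p_pr p_odd eps_gt0 eps_le s_gt0 s_le.
apply: leq_trans n_ge _; rewrite leqNgt; apply/negP => /ltnW Nn.
exact: unpopular (fromN n Nn).
Qed.
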